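(* The class of functionals represented by closed terms of $\lambda(\mathsf{SPT})$ equals the class $\mathsf{BFF}$ of basic feasible functionals, i.e. the class of functionals represented by closed terms of $\lambda(\mathsf{FP}\cup\{\mathcal R\})$.
   Context: Strings over $\{0,1\}$; $\mathcal B$ = functions $\Sigma^*\to\Sigma^*$; an operator $F\colon\mathcal B\to\mathcal B$ is identified with the type-two functional $(\varphi,\mathbf a)\mapsto F(\varphi)(\mathbf a)$. $\mathsf{SPT}$: operators computed by an oracle machine (oracle call costs one step) with a polynomial step-count (a polynomial $p$ such that the running time on $\varphi,\mathbf a$ is at most $p(m_{\varphi,\mathbf a})$, $m_{\varphi,\mathbf a}$ being the max of $|\mathbf a|$ and all oracle-answer lengths in the run) and finite length revision (some $r$ such that in every run at most $r$ times an oracle answer is longer than the input and all previous answers). $\mathsf{FP}$: polynomial-time computable string functions. $\lambda(X)$: simply-typed $\lambda$-terms (base type = strings) with a constant for each element of $X$, abstraction and application, interpreted in the full set-theoretic type structure. $\mathcal R(\varphi,\mathbf a,\mathbf b,\epsilon)=\mathbf a$, $\mathcal R(\varphi,\mathbf a,\mathbf b,\mathbf ci)=\varphi(\mathbf ci,\mathcal R(\varphi,\mathbf a,\mathbf b,\mathbf c))^{\le|\mathbf b|}$, $\mathbf x^{\le n}$ being truncation to the first $n$ symbols. *)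

(* Defs.v *)
From HB Require Import structures.
From mathcomp Require Import all_boot all_order all_algebra.
Set Implicit Arguments.
Unset Strict Implicit.
Unset Printing Implicit Defensive.

Notation str := (seq bool).

(** * Oracle Turing machines *)

Variant dir := GoLeft | Stay | GoRight.

(* The head scans the first cell of [tright]; [tleft] lists the cells to the
   left of the head, nearest first; all cells not listed are blank ([None]). *)
Record tape (S : Type) := Tape { tleft : seq (option S); tright : seq (option S) }.

Definition blank_tape (S : Type) : tape S := Tape [::] [::].

Definition scanned (S : Type) (u : tape S) : option S := head None (tright u).

Definition write_move (S : Type) (u : tape S) (x : option S) (d : dir) : tape S :=
  let l := tleft u in
  let r := behead (tright u) in
  match d with
  | GoLeft => Tape (behead l) [:: head None l, x & r]
  | Stay => Tape l (x :: r)
  | GoRight => Tape (x :: l) r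
  end.

Section Machine.

(* [k] input tapes (left summand) and an output, a query, an answer and [w] work
   tapes (right summand). *)
Definition tape_id (k w : nat) : finType := ('I_k + 'I_w.+3)%type.
Definition in_tape (k w : nat) (i : 'I_k) : tape_id k w := inl i.
Definition out_tape (k w : nat) : tape_id k w := inr (@Ordinal w.+3 0 isT).
Definition query_tape (k w : nat) : tape_id k w := inr (@Ordinal w.+3 1 isT).
Definition answer_tape (k w : nat) : tape_id k w := inr (@Ordinal w.+3 2 isT).

Variant instr (k w : nat) (Q S : Type) :=
  | Halt
  | Ask of Q
  | Move of Q & {ffun tape_id k w -> option S * dir}.

Record machine (k : nat) := Machine {
  state : finType;
  extra : finType;
  nwork : nat;
  start : state;
  delta : state -> {ffun tape_id k nwork -> option (bool + extra)%type} ->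
          instr k nwork state (bool + extra)%type
}.

Variable (k : nat) (M : machine k).

Definition symbol : Type := (bool + extra M)%type.

Record config := Config {
  cstate : state M;
  ctape : tape_id k (nwork M) -> tape symbol
}.

Definition string_tape (a : str) : tape symbol :=
  Tape [::] [seq Some (inl b : symbol) | b <- a].

Fixpoint bits (s : seq (option symbol)) : str :=
  if s is Some (inl b) :: s' then b :: bits s' else [::].

(* The string on a tape begins at the head and ends before the first cell not
   holding a bit. *)
Definition tape_string (u : tape symbol) : str := bits (tright u).

Definition init (a : k.-tuple str) : config :=
  Config (start M) (fun i => if i is inl j then string_tape (tnth a j)
                             else blank_tape symbol).

Definition output (c : config) : str := tape_string (ctape c (out_tape _ _)).
Definition query (c : config) : str := tape_string (ctape c (query_tape _ _)).

Definition current_instr (c : config) : instr k (nwork M) (state M) symbol :=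
  delta (cstate c) [ffun i => scanned (ctape c i)].

Definition answered (c : config) (q : state M) (b : str) : config :=
  Config q (fun i => if i == answer_tape _ _ then string_tape b else ctape c i).

Definition moved (c : config) (q : state M)
    (f : {ffun tape_id k (nwork M) -> option symbol * dir}) : config :=
  Config q (fun i => write_move (ctape c i) (f i).1 (f i).2).

(* [run phi c t s d]: with oracle [phi] and started in [c], the machine halts in
   configuration [d] after exactly [t] steps, having received the sequence [s] of
   oracle answers, in this order. *)
Inductive run (phi : str -> str) : config -> nat -> seq str -> config -> Prop :=
  | RunHalt c : current_instr c = Halt _ _ _ _ -> run phi c 0 [::] c
  | RunAsk c q t s d :
      current_instr c = Ask _ _ _ q ->
      run phi (answered c q (phi (query c))) t s d ->
      run phi c t.+1 (phi (query c) :: s) d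
  | RunMove c q f t s d :
      current_instr c = Move q f ->
      run phi (moved c q f) t s d ->
      run phi c t.+1 s d.

Definition oracle_free : Prop :=
  forall (q : state M) x (q' : state M), delta q x <> Ask _ _ _ q'.

End Machine.

(** * Strongly polynomial-time operators *)

Definition max_length (n : nat) (s : seq str) : nat := maxn n (\max_(b <- s) size b).

Fixpoint length_revisions (n : nat) (s : seq str) : nat :=
  if s is b :: s' then (n < size b) + length_revisions (maxn n (size b)) s' else 0.

Definition SPT (F : (str -> str) -> (str -> str)) : Prop :=
  exists (M : machine 1) (p : {poly nat}) (r : nat),
  forall (phi : str -> str) (a : str),
  exists t s d,
    [/\ run phi (init M [tuple a]) t s d,
        output d = F phi a,
        t <= (p.[max_length (size a) s])%R
      & length_revisions (size a) s <= r].

(** * The full type structure over strings *)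

Inductive ty := Base | Arr of ty & ty.

Fixpoint den (t : ty) : Type :=
  match t with
  | Base => str
  | Arr t1 t2 => den t1 -> den t2
  end.

(** * Polynomial-time string functions and limited recursion *)

Fixpoint ary (k : nat) : ty := if k is k'.+1 then Arr Base (ary k') else Base.

Fixpoint apply_ary (k : nat) : den (ary k) -> k.-tuple str -> str :=
  match k return den (ary k) -> k.-tuple str -> str with
  | 0 => fun f _ => f
  | k'.+1 => fun f a => @apply_ary k' (f (thead a)) (behead_tuple a)
  end.

Definition FP (k : nat) (f : den (ary k)) : Prop :=
  exists (M : machine k) (p : {poly nat}),
  oracle_free M /\
  forall a : k.-tuple str,
  exists t d,
    [/\ run (fun=> [::]) (init M a) t [::] d,
        output d = apply_ary f a
      & t <= (p.[\max_(i < k) size (tnth a i)])%R].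

(* Recursion on notation removes the last symbol, so it is structural on the
   reversed string; see [limrec_nil] and [limrec_rcons]. *)
Fixpoint limrec_rev (phi : str -> str -> str) (a b c : str) : str :=
  if c is _ :: c' then take (size b) (phi (rev c) (limrec_rev phi a b c')) else a.

Definition limrec (phi : str -> str -> str) (a b c : str) : str :=
  limrec_rev phi a b (rev c).

Lemma limrec_nil phi a b : limrec phi a b [::] = a.
Proof. by []. Qed.

Lemma limrec_rcons phi a b c i :
  limrec phi a b (rcons c i) = take (size b) (phi (rcons c i) (limrec phi a b c)).
Proof. by rewrite /limrec rev_rcons /= -rev_rcons revK. Qed.

(** * Lambda closure *)

Definition fclass : Type := forall t : ty, den t -> Prop.

Inductive var : seq ty -> ty -> Type :=
  | VarZ G t : var (t :: G) t
  | VarS G t t' : var G t -> var (t' :: G) t.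

Inductive term (X : fclass) : seq ty -> ty -> Type :=
  | Var G t : var G t -> term X G t
  | Cst G t (f : den t) : X t f -> term X G t
  | Lam G t1 t2 : term X (t1 :: G) t2 -> term X G (Arr t1 t2)
  | App G t1 t2 : term X G (Arr t1 t2) -> term X G t1 -> term X G t2.

Fixpoint env (G : seq ty) : Type :=
  if G is t :: G' then (den t * env G')%type else unit.

Fixpoint lookup (G : seq ty) (t : ty) (x : var G t) : env G -> den t :=
  match x in var G t return env G -> den t with
  | VarZ _ _ => fun e => e.1
  | VarS _ _ _ y => fun e => lookup y e.2
  end.

Fixpoint eval (X : fclass) (G : seq ty) (t : ty) (m : term X G t) : env G -> den t :=
  match m in term _ G t return env G -> den t with
  | Var _ _ x => fun e => lookup x e
  | Cst _ _ f _ => fun _ => f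
  | Lam _ _ _ m1 => fun e v => eval m1 (v, e)
  | App _ _ _ m1 m2 => fun e => eval m1 e (eval m2 e)
  end.

(* The functionals represented by closed terms. *)
Definition lambda (X : fclass) : fclass :=
  fun t f => exists m : term X [::] t, eval m tt = f.

Inductive SPT_class : fclass :=
  | SPT_const (F : (str -> str) -> (str -> str)) :
      SPT F -> @SPT_class (Arr (Arr Base Base) (Arr Base Base)) F.

(* Functions have at least one argument: a constant of base type would not be
   available in [lambda SPT_class]. *)
Inductive FP_class : fclass :=
  | FP_const (k : nat) (f : den (ary k.+1)) : FP f -> @FP_class (ary k.+1) f.

Inductive limrec_class : fclass :=
  | limrec_const :
      @limrec_class (Arr (Arr Base (Arr Base Base))
                         (Arr Base (Arr Base (Arr Base Base)))) limrec.

Definition cup_class (X Y : fclass) : fclass := fun t f => X t f \/ Y t f.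

Definition BFF : fclass := lambda (cup_class FP_class limrec_class).

(* Main.v *)
Require Import Defs.
From Stdlib Require Import FunctionalExtensionality.
From mathcomp Require Import all_boot all_order all_algebra.
From mathcomp Require Import zify.
Set Implicit Arguments.
Unset Strict Implicit.
Unset Printing Implicit Defensive.

(** Both classes turn out to be the closure of limited recursion and a dozen
    elementary binary string functions.

    A machine is simulated inside this closure by iterating a definable step
    function on coded configurations. The simulation takes a length bound [b]: it
    performs [p(|b|)] steps and freezes at an oracle answer longer than [b]. If it
    freezes, that answer becomes the next bound. Starting from the input, each such
    restart is a length revision of the actual run, so after as many restarts as
    there are allowed revisions the simulation is complete.

    Conversely, the elementary functions are computed by small transducers; with one
    initial oracle call such a transducer also gives an SPT operator taking its first
    argument from the oracle. Limited recursion is obtained from an SPT operator that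
    iterates its oracle and gives up when an answer is longer than the previous one;
    the intermediate values are padded so that this never happens. *)

(** * Lambda-definability *)

Section Renaming.
Variable X : fclass.

Definition renaming (G G' : seq ty) := forall t, var G t -> var G' t.

Definition lift_renaming G G' t0 (r : renaming G G') : renaming (t0 :: G) (t0 :: G') :=
  fun t (x : var (t0 :: G) t) =>
  match x in var H t return
    (if H is t1 :: H' then renaming H' G' -> var (t1 :: G') t else unit) with
  | VarZ _ t => fun _ => VarZ G' t
  | VarS _ t t' y => fun r => VarS t' (r t y)
  end r.

Fixpoint rename G t (m : term X G t) : forall G', renaming G G' -> term X G' t :=
  match m in term _ G t return forall G', renaming G G' -> term X G' t with
  | Var _ _ x => fun _ r => Var X (r _ x)
  | Cst _ _ _ Xf => fun _ _ => Cst _ Xf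
  | Lam _ _ _ m1 => fun _ r => Lam (rename m1 (lift_renaming r))
  | App _ _ _ m1 m2 => fun _ r => App (rename m1 r) (rename m2 r)
  end.

Lemma lookup_lift G G' t0 (r : renaming G G') (e : env G) (e' : env G') (v : den t0) :
  (forall t (x : var G t), lookup (r t x) e' = lookup x e) ->
  forall t (x : var (t0 :: G) t),
    lookup (lift_renaming r x) ((v, e') : env (t0 :: G')) = lookup x ((v, e) : env (t0 :: G)).
Proof.
move=> er t x; move: r e v er.
(* The motive is trivial at the empty context, so the analysis concerns exactly the variables of a
   nonempty context. *)
refine (match x as x0 in var H t return
  (match H return var H t -> Prop with
   | [::] => fun _ => True
   | t1 :: H' => fun x0 => forall (r : renaming H' G') (e : env H') (v : den t1),
      (forall t (x : var H' t), lookup (r t x) e' = lookup x e) ->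
      lookup (lift_renaming r x0) ((v, e') : env (t1 :: G'))
      = lookup x0 ((v, e) : env (t1 :: H'))
   end x0) with
  | VarZ _ _ => _ | VarS _ _ _ _ => _ end) => //= r e v er.
Qed.

Lemma eval_rename G t (m : term X G t) G' (r : renaming G G') (e : env G) (e' : env G') :
  (forall t (x : var G t), lookup (r t x) e' = lookup x e) ->
  eval (rename m r) e' = eval m e.
Proof.
elim: m G' r e e' => {G t} [G t x|G t f Xf|G t1 t2 m IHm|G t1 t2 m1 IH1 m2 IH2] G' r e e' er //=.
- apply: functional_extensionality => v; apply: IHm => t x; exact: lookup_lift.
- by rewrite (IH1 _ _ e) ?(IH2 _ _ e).
Qed.

Definition wk G t0 t (m : term X G t) : term X (t0 :: G) t :=
  rename m (fun t x => VarS t0 x).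

Lemma eval_wk G t0 t (m : term X G t) (e : env (t0 :: G)) : eval (wk t0 m) e = eval m e.2.
Proof. exact: eval_rename. Qed.

Definition wk_nil G t (m : term X [::] t) : term X G t :=
  rename m (fun t (x : var [::] t) =>
    match x in var H t return (if H is [::] then var G t else unit) with
    | VarZ _ _ => tt | VarS _ _ _ _ => tt end).

Lemma eval_wk_nil G t (m : term X [::] t) (e : env G) : eval (wk_nil G m) e = eval m tt.
Proof.
apply: eval_rename => t0 x.
by have [] : False := match x in var H _ return (if H is [::] then False else True) with
  VarZ _ _ => I | VarS _ _ _ _ => I end.
Qed.

End Renaming.

Section Definable.
Variable X : fclass.

(* The extra string argument makes string constants definable even when the
   context provides no string. *)
Definition definable G t (f : env G -> den t) : Prop :=
  exists m : term X G (Arr Base t), forall e v, eval m e v = f e.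

Lemma definable_ext G t (f g : env G -> den t) :
  f =1 g -> definable f -> definable g.
Proof. by move=> fg [m em]; exists m => e v; rewrite em fg. Qed.

Lemma definable_wk G t0 t (f : env G -> den t) :
  definable f -> definable (fun e : env (t0 :: G) => f e.2).
Proof. by case=> m em; exists (wk t0 m) => e v; rewrite eval_wk em. Qed.

Lemma definable_var0 G t : definable (fun e : env (t :: G) => e.1).
Proof. by exists (Lam (Var X (VarS Base (VarZ G t)))). Qed.

Lemma definable_app G t1 t2 (f : env G -> den (Arr t1 t2)) (a : env G -> den t1) :
  definable f -> definable a -> definable (t := t2) (fun e => f e (a e)).
Proof.
case=> mf ef [ma ea].
exists (Lam (App (App (wk Base mf) (Var X (VarZ G Base))) (App (wk Base ma) (Var X (VarZ G Base))))).
by move=> e v; rewrite /= !eval_wk ef ea.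
Qed.

(** The given term takes its dummy string inside the scope of the new variable, whereas the
    abstraction must take it outside; the witness exchanges the two. *)
Lemma definable_lam G t1 t2 (f : env G -> den t1 -> den t2) :
  definable (fun e : env (t1 :: G) => f e.2 e.1) -> definable (t := Arr t1 t2) f.
Proof.
case=> m em.
exists (Lam (Lam (App (App (wk t1 (wk Base (Lam m))) (Var X (VarZ (Base :: G) t1)))
                      (Var X (VarS t1 (VarZ G Base)))))) => e v.
apply: functional_extensionality => w.
change (eval (wk t1 (wk Base (Lam m))) (w, (v, e)) w v = f e w).
by rewrite !eval_wk /= em.
Qed.

Lemma definable_closed G t (f : den t) : lambda X f -> definable (fun _ : env G => f).
Proof.
by case=> m em; exists (Lam (wk_nil (Base :: G) m)) => e v; rewrite /= eval_wk_nil em.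
Qed.

Lemma definable_lambda t (f : den (Arr Base t)) :
  definable (fun _ : env [::] => f) -> lambda X f.
Proof.
case=> m em.
exists (Lam (App (App (wk Base m) (Var X (VarZ [::] Base))) (Var X (VarZ [::] Base)))).
by apply: functional_extensionality => v; rewrite /= !eval_wk em.
Qed.

(** The dummy string is supplied by the second argument, as the first may be of higher type. *)
Lemma definable_lambda2 t1 t2 (f : den (Arr t1 (Arr Base t2))) :
  definable (fun _ : env [::] => f) -> lambda X f.
Proof.
case=> m em; pose b : var [:: Base; t1] Base := VarZ [:: t1] Base.
exists (Lam (Lam (App (App (App (wk_nil _ m) (Var X b))
  (Var X (VarS Base (VarZ [::] t1)))) (Var X b)))).
apply: functional_extensionality => u; apply: functional_extensionality => v.
by rewrite /= !eval_wk_nil em.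
Qed.

End Definable.

(** Each constant is replaced by a closed term defining it, weakened to the local context. Comparing
    two classes thus reduces to defining the constants of each in the other. *)
Lemma lambda_sub (X Y : fclass) :
  (forall t (f : den t), X t f -> lambda Y f) ->
  forall t (f : den t), lambda X f -> lambda Y f.
Proof.
move=> sXY t f [m <-] {f}.
suff [n en] : exists n : term Y [::] t, forall e, eval n e = eval m e by exists n.
elim: m => {t} [G t x|G t f Xf|G t1 t2 m [n en]|G t1 t2 m1 [n1 e1] m2 [n2 e2]].
- by exists (Var Y x).
- by have [n en] := sXY _ _ Xf; exists (wk_nil G n) => e; rewrite eval_wk_nil en.
- by exists (Lam n) => e; apply: functional_extensionality => v /=; rewrite en.
- by exists (App n1 n2) => e /=; rewrite e1 e2.
Qed.
(** * Definability from elementary string functions *)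

Definition binary : ty := Arr Base (Arr Base Base).

(** Self-delimiting code: [true] precedes every bit of the first component and [false] announces the
    second, so a finite-state scan can build and decode it. *)
Fixpoint pair_str (a b : str) : str :=
  if a is x :: a' then [:: true, x & pair_str a' b] else false :: b.

Fixpoint fst_str (z : str) : str :=
  if z is [:: true, x & z'] then x :: fst_str z' else [::].

Fixpoint snd_str (z : str) : str :=
  match z with
  | [:: true, _ & z'] => snd_str z'
  | false :: z' => z'
  | _ => [::]
  end.

Lemma pair_strK a b : fst_str (pair_str a b) = a.
Proof. by elim: a => //= x a ->. Qed.

Lemma pair_strK2 a b : snd_str (pair_str a b) = b.
Proof. by elim: a. Qed.

Lemma size_pair_str a b : size (pair_str a b) = (size a).*2 + (size b).+1.
Proof. by elim: a => //= x a ->; rewrite doubleS !addSn. Qed.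

(* Reads a bit string off the indicator sequences of the cells holding [true]
   and of the cells holding [false]. *)
Fixpoint read_bits (p q : str) : str :=
  match p, q with
  | x :: p', y :: q' => if x || y then x :: read_bits p' q' else [::]
  | _, _ => [::]
  end.

(** The uniform arity lets one machine format with two inputs serve all of them. Gates provide case
    distinctions; the last function multiplies lengths and so yields polynomial clocks. *)
Inductive basic : den binary -> Prop :=
  | basic_bit x : basic (fun _ _ => [:: x])
  | basic_cat : basic (fun a b => a ++ b)
  | basic_gate x : basic (fun a b => if head false a == x then b else [::])
  | basic_behead : basic (fun a _ => behead a)
  | basic_take : basic (fun a b => take (size a) b)
  | basic_drop : basic (fun a b => drop (size a) b)
  | basic_pair : basic pair_str
  | basic_fst : basic (fun a _ => fst_str a)
  | basic_snd : basic (fun a _ => snd_str a)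
  | basic_read_bits : basic read_bits
  | basic_map h : basic (fun a _ => map h a)
  | basic_smash : basic (fun a b => nseq (size a * size b) true).

Definition basic_closed (X : fclass) : Prop :=
  forall f : den binary, basic f -> lambda X f.

Section BasicDefinable.
Variable X : fclass.
Hypothesis bX : basic_closed X.
Variable G : seq ty.
Local Notation D := (@definable X G Base).
Implicit Types u v : env G -> str.

Lemma def_basic f u v : basic f -> D u -> D v -> D (fun e => f (u e) (v e)).
Proof.
move=> /bX/(@definable_closed X G) Df Du Dv.
exact: (definable_app (t1 := Base) (t2 := Base) (definable_app (t1 := Base) Df Du) Dv).
Qed.

Lemma def_bit x : D (fun=> [:: x]).
Proof.
have [m em] := bX (basic_bit x).
exists (Lam (App (App (wk_nil _ m) (Var X (VarZ G Base))) (Var X (VarZ G Base)))) => e v /=.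
by rewrite eval_wk_nil em.
Qed.

Lemma def_cat u v : D u -> D v -> D (fun e => u e ++ v e).
Proof. exact: def_basic basic_cat. Qed.

Lemma def_nil : D (fun=> [::]).
Proof. exact: (def_basic (basic_gate true) (def_bit false) (def_bit false)). Qed.

Lemma def_const (w : str) : D (fun=> w).
Proof.
elim: w => [|x w IHw]; first exact: def_nil.
exact: (def_cat (def_bit x) IHw).
Qed.

Lemma def_behead u : D u -> D (fun e => behead (u e)).
Proof. by move=> Du; exact: (def_basic basic_behead Du Du). Qed.

Lemma def_take u v : D u -> D v -> D (fun e => take (size (u e)) (v e)).
Proof. exact: def_basic basic_take. Qed.

Lemma def_drop u v : D u -> D v -> D (fun e => drop (size (u e)) (v e)).
Proof. exact: def_basic basic_drop. Qed.

Lemma def_pair u v : D u -> D v -> D (fun e => pair_str (u e) (v e)).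
Proof. exact: def_basic basic_pair. Qed.

Lemma def_fst u : D u -> D (fun e => fst_str (u e)).
Proof. by move=> Du; exact: (def_basic basic_fst Du Du). Qed.

Lemma def_snd u : D u -> D (fun e => snd_str (u e)).
Proof. by move=> Du; exact: (def_basic basic_snd Du Du). Qed.

Lemma def_read_bits u v : D u -> D v -> D (fun e => read_bits (u e) (v e)).
Proof. exact: def_basic basic_read_bits. Qed.

Lemma def_map h u : D u -> D (fun e => map h (u e)).
Proof. by move=> Du; exact: (def_basic (basic_map h) Du Du). Qed.

Lemma def_smash u v : D u -> D v -> D (fun e => nseq (size (u e) * size (v e)) true).
Proof. exact: def_basic basic_smash. Qed.

Lemma def_if_head w u v : D w -> D u -> D v ->
  D (fun e => if head false (w e) then u e else v e).
Proof.
(* One gate lets its string through and the other yields the empty string, so the concatenation is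
   the selected branch. *)
move=> Dw Du Dv; apply: definable_ext (def_cat (def_basic (basic_gate true) Dw Du)
  (def_basic (basic_gate false) Dw Dv)) => e /=.
by case: head; rewrite ?cats0.
Qed.

Definition decidable_in (c : env G -> bool) : Prop := D (fun e => [:: c e]).

Lemma dec_head u : D u -> decidable_in (fun e => head false (u e)).
Proof.
move=> Du; apply: definable_ext (def_if_head Du (def_bit true) (def_bit false)) => e.
by case: head.
Qed.

Lemma def_if c u v : decidable_in c -> D u -> D v ->
  D (fun e => if c e then u e else v e).
Proof. by move=> Dc Du Dv; exact: (def_if_head Dc Du Dv). Qed.

Lemma dec_and c1 c2 : decidable_in c1 -> decidable_in c2 ->
  decidable_in (fun e => c1 e && c2 e).
Proof.
move=> D1 D2; apply: definable_ext (def_if D1 D2 (def_bit false)) => e.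
by case: (c1 e).
Qed.

Lemma dec_lt_size u v : D u -> D v -> decidable_in (fun e => size (u e) < size (v e)).
Proof.
move=> Du Dv.
(* The rest of [v] beyond the length of [u] is nonempty exactly when the test holds; only then does
   the bit [true] survive truncation to its length. *)
apply: definable_ext (dec_head (def_take (def_drop Du Dv) (def_bit true))) => e.
congr [:: _]; rewrite -subn_gt0 -size_drop.
by case: (drop _ _).
Qed.

Lemma def_case (K : finType) (c : env G -> K) (w : K -> env G -> str) :
  (forall k, decidable_in (fun e => c e == k)) -> (forall k, D (w k)) ->
  D (fun e => w (c e) e).
Proof.
move=> Dc Dw.
pose r s e := foldr (fun k acc => if c e == k then w k e else acc) [::] s.
have Dr s : D (r s).
  by elim: s => [|k s IHs]; [exact: def_nil | exact: (def_if (Dc k) (Dw k) IHs)].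
apply: definable_ext (Dr (enum K)) => e; rewrite /r.
have: c e \in enum K by rewrite mem_enum.
by elim: (enum K) => //= k s IHs; rewrite inE; case: eqP => [->|_] //=.
Qed.

Lemma dec_ffun (I : finType) (c : I -> env G -> bool) :
  (forall i, decidable_in (c i)) ->
  forall k : {ffun I -> bool}, decidable_in (fun e => [ffun i => c i e] == k).
Proof.
move=> Dc k.
have Dk i : decidable_in (fun e => c i e == k i).
  case: (k i); first by apply: definable_ext (Dc i) => e; rewrite eqb_id.
  apply: definable_ext (def_if (Dc i) (def_bit false) (def_bit true)) => e.
  by case: (c i e).
have Ds s : decidable_in (fun e => all (fun i => c i e == k i) s).
  by elim: s => [|i s IHs]; [exact: def_bit | exact: (dec_and (Dk i) IHs)].
apply: definable_ext (Ds (enum I)) => e; congr [:: _].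
apply/allP/eqP => [h|<- i _]; last by rewrite ffunE.
by apply/ffunP => i; rewrite ffunE; apply/eqP/h; rewrite mem_enum.
Qed.

End BasicDefinable.

Lemma def_call (X : fclass) G (p : env G -> str -> str) (u : env G -> str) :
  definable X (t := Arr Base Base) p -> definable X (t := Base) u ->
  definable X (t := Base) (fun e => p e (u e)).
Proof. exact: (@definable_app X G Base Base). Qed.

(** * Coding of finite families, iteration and clocks *)

Fixpoint tuple_code (s : seq str) : str :=
  if s is a :: s' then pair_str a (tuple_code s') else [::].

Lemma nth_tuple_code s i :
  i < size s -> fst_str (iter i snd_str (tuple_code s)) = nth [::] s i.
Proof.
elim: s i => // a s IHs [|i] /= lt_i; first by rewrite pair_strK.
by rewrite -IHs // -iterS iterSr pair_strK2.
Qed.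

Lemma size_tuple_code s N :
  all (fun a => size a <= N) s -> size (tuple_code s) <= size s * N.*2.+1.
Proof.
elim: s => //= a s IHs /andP[aN /IHs sN]; rewrite size_pair_str mulSn.
by move: aN sN; rewrite -!muln2; lia.
Qed.

Definition family_code (J : finType) (w : J -> str) : str :=
  tuple_code [seq w j | j <- enum J].

Definition family_proj (J : finType) (j : J) (z : str) : str :=
  fst_str (iter (index j (enum J)) snd_str z).

Lemma family_codeK (J : finType) (w : J -> str) j : family_proj j (family_code w) = w j.
Proof.
have ltj : index j (enum J) < size (enum J) by rewrite index_mem mem_enum.
rewrite /family_proj /family_code nth_tuple_code; last by rewrite size_map.
by rewrite (nth_map j) // nth_index // mem_enum.
Qed.

Lemma eq_family_code (J : finType) (w1 w2 : J -> str) :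
  w1 =1 w2 -> family_code w1 = family_code w2.
Proof. by move=> ew; congr tuple_code; exact: eq_map. Qed.

Lemma size_family_code (J : finType) (w : J -> str) N :
  (forall j, size (w j) <= N) -> size (family_code w) <= #|J| * N.*2.+1.
Proof.
move=> wN; have -> : #|J| = size [seq w j | j <- enum J] by rewrite size_map cardE.
by apply: size_tuple_code; apply/allP => _ /mapP[j _ ->].
Qed.

Lemma def_family_code X (bX : basic_closed X) G (J : finType) (w : J -> env G -> str) :
  (forall j, definable X (t := Base) (w j)) ->
  definable X (t := Base) (fun e => family_code (w ^~ e)).
Proof.
move=> Dw; rewrite /family_code; elim: (enum J) => [|j s IHs] /=; first exact: def_nil.
exact: (def_pair bX (Dw j) IHs).
Qed.

Lemma def_family_proj X (bX : basic_closed X) G (J : finType) (j : J) (z : env G -> str) :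
  definable X (t := Base) z -> definable X (t := Base) (fun e => family_proj j (z e)).
Proof.
move=> Dz; apply: def_fst => //.
by elim: (index _ _) => //= n IHn; apply: def_snd.
Qed.

Definition limrec_ty : ty := Arr binary (Arr Base (Arr Base (Arr Base Base))).

Lemma limrec_iter p a b c :
  limrec (fun=> p) a b c = iter (size c) (fun y => take (size b) (p y)) a.
Proof.
elim/last_ind: c => [|c i IHc]; first by [].
by rewrite limrec_rcons size_rcons /= IHc.
Qed.

(** This turns limited recursion into plain iteration: a space bound on the iterates makes the
    truncation invisible. *)
Lemma iter_take (p : str -> str) n a N :
  (forall i, i <= n -> size (iter i p a) <= N) ->
  iter n (fun y => take N (p y)) a = iter n p a.
Proof.
elim: n => //= n IHn h; rewrite IHn => [|i ltin]; last exact/h/leqW.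
by rewrite take_oversize // (h n.+1).
Qed.

Lemma def_limrec X (lX : lambda X (limrec : den limrec_ty)) G p (a b c : env G -> str) :
  definable X (t := Arr Base Base) p -> definable X (t := Base) a ->
  definable X (t := Base) b -> definable X (t := Base) c ->
  definable X (t := Base) (fun e => limrec (fun=> p e) (a e) (b e) (c e)).
Proof.
move=> Dp Da Db Dc; have DL := @definable_closed X G _ _ lX.
have Dp' : definable X (t := binary) (fun e (_ : str) => p e).
  apply: (@definable_lam X G Base (Arr Base Base)); exact: definable_wk.
exact: (definable_app (t1 := Base) (definable_app (t1 := Base)
  (definable_app (t1 := Base) (definable_app (t1 := binary) DL Dp') Da) Db) Dc).
Qed.

Lemma horner_homo (p : {poly nat}) m n : m <= n -> (p.[m]%R <= p.[n]%R)%N.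
Proof.
move=> lemn; elim/poly_ind: p => [|p c IHp]; first by rewrite !horner0.
by rewrite !hornerMXaddC leq_add2r leq_mul.
Qed.

(** Horner's rule on lengths, with smash for products and concatenation for sums. The strings
    obtained serve as clocks. *)
Lemma def_poly X (bX : basic_closed X) (p : {poly nat}) : exists g : str -> str,
  (forall G (u : env G -> str), definable X (t := Base) u ->
     definable X (t := Base) (fun e => g (u e))) /\
  forall a, (p.[size a]%R <= size (g a))%N.
Proof.
elim/poly_ind: p => [|p c [g [Dg gP]]].
  by exists (fun=> [::]); split=> [G u _|a]; [exact: def_nil | rewrite horner0].
exists (fun a => nseq (size (g a) * size a) true ++ nseq c true).
split=> [G u Du|a].
  by apply: def_cat => //; [apply: def_smash => //; exact: Dg | exact: def_const].
by rewrite hornerMXaddC size_cat !size_nseq leq_add2r leq_mul.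
Qed.

(** * Runs and bounded simulation *)

Lemma pick_Some (T : finType) (x : option T) : [pick s | x == Some s] = x.
Proof. by case: pickP => [s /eqP // |]; case: x => // s /(_ s); rewrite eqxx. Qed.

Section Runs.
Variables (k : nat) (M : machine k).
Implicit Types (phi : str -> str) (c d : config M).

Lemma run_halt_inv phi c t s d :
  current_instr c = Halt _ _ _ _ -> run phi c t s d -> [/\ t = 0, s = [::] & d = c].
Proof. by move=> ec h; case: h ec => {}c *; split=> //; congruence. Qed.

Lemma run_ask_inv phi c q t s d :
  current_instr c = Ask _ _ _ q -> run phi c t s d ->
  exists t' s', [/\ t = t'.+1, s = phi (query c) :: s' &
    run phi (answered c q (phi (query c))) t' s' d].
Proof.
move=> ec h; case: h ec => {t s d} {}c; first by move=> ->.
  by move=> q' t s d -> h [<-]; exists t, s.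
by move=> q' f t s d ->.
Qed.

Lemma run_move_inv phi c q f t s d :
  current_instr c = Move q f -> run phi c t s d ->
  exists2 t', t = t'.+1 & run phi (moved c q f) t' s d.
Proof.
move=> ec h; case: h ec => {t s d} {}c; first by move=> ->.
  by move=> q' t s d ->.
by move=> q' f' t s d -> h [<- <-]; exists t.
Qed.

Lemma run_functional phi c t s d t' s' d' :
  run phi c t s d -> run phi c t' s' d' -> s = s' /\ d = d'.
Proof.
move=> h; elim: h t' s' d' => {c t s d}.
- by move=> c ec t' s' d' /(run_halt_inv ec)[_ -> ->].
- move=> c q t s d ec _ IH t' s' d' /(run_ask_inv ec)[t1 [s1 [_ -> /IH[<- <-]]]] //.
- by move=> c q f t s d ec _ IH t' s' d' /(run_move_inv ec)[t1 _ /IH].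
Qed.

Lemma run_answers phi (P : pred str) c t s d :
  run phi c t s d -> (forall x, P (phi x)) -> all P s.
Proof. by move=> h Pphi; elim: h => //= *; rewrite Pphi. Qed.

Lemma run_oracle_free phi phi' c t s d :
  oracle_free M -> run phi c t s d -> run phi' c t s d.
Proof.
move=> Mfree; elim=> {c t s d} [c|c q t s d|c q f t s d]; first exact: RunHalt.
  by rewrite /current_instr => /Mfree.
by move=> ec _; apply: RunMove.
Qed.

(** Halted configurations and those facing an answer longer than [b] are fixed points, so surplus
    steps do no harm. *)
Definition bounded_step phi (b : str) c : config M :=
  match current_instr c with
  | Halt => c
  | Ask q => if size b < size (phi (query c)) then c
             else answered c q (phi (query c))
  | Move q f => moved c q f
  end.

Definition cut_oracle phi (b : str) : str -> str :=
  fun x => if size b < size (phi x) then [::] else phi x.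

Lemma size_cut_oracle phi b x : size (cut_oracle phi b x) <= size b.
Proof. by rewrite /cut_oracle; case: ltnP. Qed.

(* Comparing with the oracle [cut_oracle phi b] bounds the time until the bounded
   simulation gets stuck, even though a step count only bounds complete runs. *)
Lemma bounded_stepP phi b c t s d n :
  run (cut_oracle phi b) c t s d -> t <= n ->
  let c' := iter n (bounded_step phi b) c in
  [/\ c' = d, run phi c t s d & all (fun x => size x <= size b) s] \/
  size b < size (phi (query c')) /\
  forall t1 s1 d1, run phi c t1 s1 d1 ->
    exists s0 s2, s1 = s0 ++ phi (query c') :: s2 /\ all (fun x => size x <= size b) s0.
Proof.
move=> h; elim: h n => {c t s d} [c ec|c q t s d ec _ IH|c q f t s d ec _ IH] n letn /=.
- left; split=> //; last exact: RunHalt.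
  by apply: iter_fix; rewrite /bounded_step ec.
- case: n letn => // n letn; rewrite iterSr.
  have: bounded_step phi b c = if size b < size (phi (query c)) then c
    else answered c q (phi (query c)) by rewrite /bounded_step ec.
  rewrite {1}/cut_oracle /cut_oracle in IH *; case: ltnP IH => [lt _|le IH] ->.
    (* Stuck at once: every run with [phi] itself first receives this overlong answer, so the list
       of short answers before it is empty. *)
    right; rewrite iter_fix; last by rewrite /bounded_step ec lt.
    split=> // t1 s1 d1 /(run_ask_inv ec)[t' [s' [_ -> _]]].
    by exists [::], s'.
  case: (IH n letn) => [[e h sb]|[lt h]]; [left|right].
    by split=> //; [exact: RunAsk ec h | rewrite /= le].
  split=> // t1 s1 d1 /(run_ask_inv ec)[t' [s' [_ -> /h[s0 [s2 [-> sb]]]]]].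
  by exists (phi (query c) :: s0), s2; split; rewrite //= le.
- case: n letn => // n letn; rewrite iterSr.
  have -> : bounded_step phi b c = moved c q f by rewrite /bounded_step ec.
  case: (IH n letn) => [[e h sb]|[lt h]]; [left|right].
    by split=> //; exact: RunMove ec h.
  by split=> // t1 s1 d1 /(run_move_inv ec)[t' _ /h].
Qed.

Lemma max_length_bound n s N :
  n <= N -> all (fun x : str => size x <= N) s -> max_length n s <= N.
Proof.
move=> nN /allP sN; rewrite /max_length geq_max nN /=.
rewrite big_seq; elim/big_ind: _ => // m1 m2 h1 h2.
by rewrite geq_max h1.
Qed.

End Runs.

Lemma length_revisions_eq0 n s :
  length_revisions n s = 0 -> all (fun x => size x <= n) s.
Proof.
elim: s n => //= x s IHs n; case: ltnP => //= le.
by rewrite add0n => /IHs.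
Qed.

Lemma length_revisions_cat n s0 s :
  all (fun x => size x <= n) s0 -> length_revisions n (s0 ++ s) = length_revisions n s.
Proof.
elim: s0 => //= x s0 IHs /andP[xn /IHs <-].
by rewrite ltnNge xn (maxn_idPl xn).
Qed.

(** Invariant: at most [r] revisions remain, counted from the current bound. A restart either finds
    all answers short, or adopts the first answer exceeding the bound and thereby uses up one
    revision. *)
Lemma iter_revisions (s : seq str) (next : str -> str) (N : nat) (b : str) r :
  (forall b', N <= size b' -> size b' <= size (next b') /\
    (all (fun x => size x <= size b') s \/
     exists s0 s2, [/\ s = s0 ++ next b' :: s2, size b' < size (next b')
                     & all (fun x => size x <= size b') s0])) ->
  N <= size b -> length_revisions (size b) s <= r ->
  N <= size (iter r next b) /\ all (fun x => size x <= size (iter r next b)) s.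
Proof.
move=> nextP; elim: r b => [|r IHr] b Nb.
  by rewrite leqn0 => /eqP/length_revisions_eq0.
have mono n n' (s0 : seq str) : n <= n' -> all (fun x => size x <= n) s0 ->
    all (fun x => size x <= n') s0.
  by move=> nn'; apply: sub_all => x /leq_trans; apply.
rewrite iterSr; have [le [al _|[s0 [s2 [es lt al]]]]] := nextP b Nb.
  apply: IHr; first exact: leq_trans le.
  by rewrite -[s]cats0 length_revisions_cat //; exact: mono al.
rewrite {1}es length_revisions_cat //= lt add1n ltnS => hr.
apply: IHr; first exact: leq_trans le.
(* Counted from the new bound, neither the answers in [s0] nor the adopted answer are revisions any
   more. *)
rewrite es length_revisions_cat /=; last exact: mono al.
by rewrite ltnn maxnn add0n; move: hr; rewrite (maxn_idPr (ltnW lt)).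
Qed.

(** * Coded configurations *)

Section Simulation.
Variables (k : nat) (M : machine k).
Local Notation sym := (bool + extra M)%type.
Local Notation tid := (tape_id k (nwork M)).

(* A configuration is coded by bit strings: an indicator of each state and, for
   each half tape and each symbol, the indicator sequence of its cells holding
   that symbol. *)
Definition field : finType := (state M + tid * bool * sym)%type.

Definition plane (s : sym) (x : seq (option sym)) : str := [seq y == Some s | y <- x].

Definition half (u : tape sym) (right : bool) : seq (option sym) :=
  if right then tright u else tleft u.

Definition config_field (c : config M) (j : field) : str :=
  match j with
  | inl q => [:: cstate c == q]
  | inr (i, side, s) => plane s (half (ctape c i) side)
  end.

Definition config_code (c : config M) : str := family_code (config_field c).

Definition heads (z : str) : {ffun field -> bool} :=
  [ffun j => head false (family_proj j z)].

Definition state_of (h : {ffun field -> bool}) : state M :=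
  odflt (start M) [pick q | h (inl q)].

Definition scan_of (h : {ffun field -> bool}) : {ffun tid -> option sym} :=
  [ffun i => [pick s | h (inr (i, true, s))]].

Definition code_string (i : tid) (z : str) : str :=
  read_bits (family_proj (inr (i, true, inl true) : field) z)
            (family_proj (inr (i, true, inl false) : field) z).

Definition ask_field (q : state M) (ans z : str) (j : field) : str :=
  match j with
  | inl q' => [:: q == q']
  | inr (i, side, s) =>
      if i == answer_tape _ _ then
        if side then [seq (inl x : sym) == s | x <- ans] else [::]
      else family_proj j z
  end.

Definition move_field (q : state M) (f : {ffun tid -> option sym * dir})
    (h : {ffun field -> bool}) (z : str) (j : field) : str :=
  match j with
  | inl q' => [:: q == q']
  | inr (i, side, s) =>
      let l := family_proj (inr (i, false, s) : field) z in
      let r := family_proj (inr (i, true, s) : field) z in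
      let w := (f i).1 == Some s in
      match (f i).2, side with
      | GoLeft, false => behead l
      | GoLeft, true => [:: h (inr (i, false, s)), w & behead r]
      | Stay, false => l
      | Stay, true => w :: behead r
      | GoRight, false => w :: l
      | GoRight, true => behead r
      end
  end.

(** [h] stands for the heads of [z]. Once it is fixed to one of its finitely many values, the
    instruction is known and the update is composed of elementary functions and [phi]. *)
Definition code_step_at (phi : str -> str) (b : str) (h : {ffun field -> bool}) (z : str) :=
  match delta (state_of h) (scan_of h) with
  | Halt => z
  | Ask q => if size b < size (phi (code_string (query_tape _ _) z)) then z
             else family_code (ask_field q (phi (code_string (query_tape _ _) z)) z)
  | Move q f => family_code (move_field q f h z)
  end.

Definition code_step phi b z := code_step_at phi b (heads z) z.

Lemma head_plane s x : head false (plane s x) = (head None x == Some s).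
Proof. by case: x. Qed.

Lemma heads_code c : heads (config_code c) = [ffun j => head false (config_field c j)].
Proof. by apply/ffunP => j; rewrite !ffunE family_codeK. Qed.

Lemma state_of_code c : state_of (heads (config_code c)) = cstate c.
Proof.
rewrite heads_code /state_of; case: pickP => [q|/(_ (cstate c))]; rewrite ffunE /=.
  by move/eqP.
by rewrite eqxx.
Qed.

Lemma scan_of_code c :
  scan_of (heads (config_code c)) = [ffun i => scanned (ctape c i)].
Proof.
rewrite heads_code; apply/ffunP => i; rewrite !ffunE -[RHS]pick_Some.
by apply: eq_pick => s; rewrite ffunE /= head_plane.
Qed.

Lemma read_bits_planes x : read_bits (plane (inl true) x) (plane (inl false) x) = @bits k M x.
Proof. by elim: x => //= [[[[]|s]|]] x IHx //=; rewrite -IHx. Qed.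

Lemma code_stringE i c : code_string i (config_code c) = tape_string (ctape c i).
Proof. by rewrite /code_string !family_codeK read_bits_planes. Qed.

Lemma code_stepE phi b c :
  code_step phi b (config_code c) = config_code (bounded_step phi b c).
Proof.
rewrite /code_step /code_step_at state_of_code scan_of_code /bounded_step /current_instr.
case: delta => [//|q|q f].
  rewrite code_stringE -/(query c); case: ltnP => // _.
  apply: eq_family_code => -[q'|[[i side] s]] //=.
  case: eqP => [_|_]; last by rewrite family_codeK.
  by case: side => //=; rewrite /plane -map_comp.
apply: eq_family_code => -[q'|[[i side] s]] //=.
rewrite !family_codeK heads_code ffunE /= head_plane /plane.
case: (f i) => w []; case: side => //=; rewrite -?behead_map //.
Qed.

Lemma iter_code_step phi b n c :
  iter n (code_step phi b) (config_code c) = config_code (iter n (bounded_step phi b) c).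
Proof. by elim: n => //= n ->; rewrite code_stepE. Qed.

Definition space_bounded (c : config M) N := forall i side, size (half (ctape c i) side) <= N.

(** Growth by two occurs when the head moves left with nothing listed to its right: the new right
    half then lists two cells. *)
Lemma space_bounded_step phi b c N :
  size b <= N -> space_bounded c N -> space_bounded (bounded_step phi b c) N.+2.
Proof.
have leS2 m : m <= N -> m <= N.+2 by move=> ?; rewrite !leqW.
move=> bN cN; rewrite /bounded_step; case: current_instr => [|q|q f] i side; first exact/leS2/cN.
  case: ltnP => [_|le]; first exact/leS2/cN.
  rewrite /answered /=; case: eqP => _; last exact/leS2/cN.
  by case: side => //=; rewrite size_map; apply/leS2/(leq_trans le).
have := cN i true; have := cN i false; rewrite /moved /half /write_move /=.
case: (f i).2; case: side => /=; rewrite ?size_behead;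
  move: (size (tleft (ctape c i))) (size (tright (ctape c i))) => m n; lia.
Qed.

Lemma space_bounded_iter phi b c N n :
  size b <= N -> space_bounded c N -> space_bounded (iter n (bounded_step phi b) c) (N + n.*2).
Proof.
move=> bN cN; elim: n => [|n IHn]; first by rewrite addn0.
by rewrite doubleS !addnS; apply: space_bounded_step => //; lia.
Qed.

Lemma space_bounded_init (a : k.-tuple str) N :
  (forall i, size (tnth a i) <= N) -> space_bounded (init M a) N.
Proof. by move=> aN [i|i] [] //=; rewrite size_map. Qed.

Lemma size_config_code c N : space_bounded c N -> size (config_code c) <= #|field| * N.+1.*2.+1.
Proof.
move=> cN; apply: size_family_code => -[q|[[i side] s]] //=.
by rewrite size_map leqW.
Qed.

(** Its length bounds the code of any configuration reached within [size n] steps: a step adds at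
    most two cells to a half tape, and one more unit makes room for the one-bit state fields. *)
Definition space (b n : str) : str :=
  iter #|field| (cat (b ++ b ++ n ++ n ++ n ++ n ++ nseq 3 true)) [::].

Definition simulate (phi : str -> str) (a : k.-tuple str) (b n : str) : str :=
  limrec (fun=> code_step phi b) (config_code (init M a)) (space b n) n.

Lemma size_space b n : size (space b n) = #|field| * (size b + (size n).*2).+1.*2.+1.
Proof.
rewrite /space; elim: #|field| => //= m IHm.
by rewrite !size_cat IHm mulSn /= -!muln2; lia.
Qed.

Lemma simulateE phi a b n : (forall i, size (tnth a i) <= size b) ->
  simulate phi a b n = config_code (iter (size n) (bounded_step phi b) (init M a)).
Proof.
move=> ab; rewrite /simulate limrec_iter -iter_code_step; apply: iter_take => i le_in.
rewrite iter_code_step size_space.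
apply: leq_trans (size_config_code (space_bounded_iter phi i (leqnn (size b)) (space_bounded_init ab))) _.
by rewrite leq_mul2l; apply/orP; right; move: le_in; rewrite -!muln2; lia.
Qed.

Section Definability.
Variable X : fclass.
Hypothesis bX : basic_closed X.
Hypothesis lX : lambda X (limrec : den limrec_ty).

Lemma def_code_string G i (z : env G -> str) :
  definable X (t := Base) z -> definable X (t := Base) (fun e => code_string i (z e)).
Proof. by move=> Dz; apply: def_read_bits => //; apply: def_family_proj. Qed.

Lemma def_code_step G (phi : env G -> str -> str) (b z : env G -> str) :
  definable X (t := Arr Base Base) phi -> definable X (t := Base) b ->
  definable X (t := Base) z -> definable X (t := Base) (fun e => code_step (phi e) (b e) (z e)).
Proof.
move=> Dphi Db Dz.
have Dp j : definable X (t := Base) (fun e => family_proj (j : field) (z e)).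
  exact: def_family_proj.
apply: (def_case bX (c := fun e => heads (z e))
          (w := fun h e => code_step_at (phi e) (b e) h (z e))).
  by apply: dec_ffun => // j; apply: dec_head.
move=> h; rewrite /code_step_at; case: delta => [//|q|q f].
  have Da := def_call Dphi (def_code_string (query_tape _ _) Dz).
  apply: def_if => //; first exact: dec_lt_size.
  apply: def_family_code => // -[q'|[[i []] s]] /=; first exact: def_const.
    by case: eqP => _; [exact: def_map | exact: Dp].
  by case: eqP => _; [exact: def_nil | exact: Dp].
apply: def_family_code => // -[q'|[[i side] s]] /=; first exact: def_const.
have Dbe j := def_behead bX (Dp j).
have Dcons x u : definable X (t := Base) u -> definable X (t := Base) (fun e : env G => x :: u e).
  by move=> Du; exact: (def_cat bX (def_bit bX G x) Du).
by case: (f i).2; case: side; do ?apply: (Dcons); first [exact: Dbe | exact: Dp].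
Qed.

Lemma def_config_code_init G (a : 'I_k -> env G -> str) :
  (forall i, definable X (t := Base) (a i)) ->
  definable X (t := Base) (fun e => config_code (init M [tuple a i e | i < k])).
Proof.
move=> Da; apply: def_family_code => // -[q|[[[i|i] []] s]] /=; try exact: def_const.
apply: definable_ext (def_map bX (fun x => inl x == s) (Da i)) => e.
by rewrite tnth_mktuple /plane -map_comp.
Qed.

Lemma def_simulate G (phi : env G -> str -> str) (a : 'I_k -> env G -> str) (b n : env G -> str) :
  definable X (t := Arr Base Base) phi -> (forall i, definable X (t := Base) (a i)) ->
  definable X (t := Base) b -> definable X (t := Base) n ->
  definable X (t := Base) (fun e => simulate (phi e) [tuple a i e | i < k] (b e) (n e)).
Proof.
move=> Dphi Da Db Dn; apply: def_limrec => //.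
- apply: definable_lam; apply: def_code_step; last exact: definable_var0.
    exact: (definable_wk Base Dphi).
  exact: (definable_wk Base Db).
- exact: def_config_code_init.
rewrite /space; elim: #|field| => [|m IHm] /=; first exact: def_nil.
by do ?apply: def_cat => //; exact: def_const.
Qed.

End Definability.
End Simulation.

(** * Machine-computed functionals are definable *)

Lemma SPT_lambda X (F : den (Arr (Arr Base Base) (Arr Base Base))) :
  basic_closed X -> lambda X (limrec : den limrec_ty) -> SPT F -> lambda X F.
Proof.
move=> bX lX [M [p [r MP]]]; have [g [Dg gP]] := def_poly bX p.
pose arg (a : str) : 1.-tuple str := [tuple a | i < 1].
have argE a : arg a = [tuple a] by apply: eq_from_tnth => i; rewrite tnth_mktuple (ord1 i).
pose sim phi a b := simulate M phi (arg a) b (g b).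
(* After a halt the query tape may still yield a longer answer. The bound then grows harmlessly,
   since any bound covering the input and the actual answers gives the right result. *)
pose next phi a b := let ans := phi (code_string (M := M) (query_tape _ _) (sim phi a b)) in
  if size b < size ans then ans else b.
pose result phi a := code_string (M := M) (out_tape _ _) (sim phi a (iter r (next phi a) a)).
suff -> : F = result.
  apply: definable_lambda2; apply: definable_lam; apply: definable_lam.
  have Dphi := definable_wk Base (definable_var0 X [::] (Arr Base Base)).
  have Da := definable_var0 X [:: Arr Base Base] Base.
  have Dsim (b : env [:: Base; Arr Base Base] -> str) : definable X (t := Base) b ->
      definable X (t := Base) (fun e : env [:: Base; Arr Base Base] => sim e.2.1 e.1 (b e)).
    by move=> Db; exact: (def_simulate M (G := [:: Base; Arr Base Base]) (a := fun _ e => e.1)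
      bX lX Dphi (fun=> Da) Db (Dg _ _ Db)).
  apply: def_code_string => //; apply: (Dsim); elim: r {MP result} => //= r IHr.
  have Dans := def_call Dphi (def_code_string bX (query_tape _ _) (Dsim _ IHr)).
  apply: def_if => //; exact: dec_lt_size.
apply: functional_extensionality => phi; apply: functional_extensionality => a.
have [t [s [d [hrun <- _ rev_s]]]] := MP phi a.
have simP b : size a <= size b ->
    let c := iter (size (g b)) (bounded_step phi b) (init M [tuple a]) in
    sim phi a b = config_code c /\
    (c = d /\ all (fun x => size x <= size b) s \/
     exists s0 s2, [/\ s = s0 ++ phi (query c) :: s2, size b < size (phi (query c))
                     & all (fun x => size x <= size b) s0]).
  move=> ab c; split; first by rewrite /sim argE simulateE // => i; rewrite (ord1 i).
  (* On the cut oracle all answers are within [b], so the running time is at most [p] at [size b],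
     which the clock [g b] covers. *)
  have [t' [s' [d' [hrun' _ tp _]]]] := MP (cut_oracle phi b) a.
  have s'b := run_answers (P := fun x => size x <= size b) hrun' (size_cut_oracle phi b).
  have tg : t' <= size (g b).
    apply: leq_trans (gP b); apply: leq_trans tp _; apply: horner_homo.
    exact: max_length_bound.
  case: (bounded_stepP hrun' tg) => [[cd /(run_functional hrun)[-> ->] _]|[lt h]].
    by left.
  by right; have [s0 [s2 [es s0b]]] := h _ _ _ hrun; exists s0, s2.
have [] := @iter_revisions s (next phi a) (size a) a r _ (leqnn _) rev_s.
  move=> b ab; have [simE dich] := simP b ab; rewrite /next simE code_stringE -/(query _).
  split; first by case: ltnP => // /ltnW.
  case: dich => [[_ al]|[s0 [s2 [es lt s0b]]]]; first by left.
  by right; exists s0, s2; rewrite lt.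
set b := iter r _ a => ab sb; have [simE dich] := simP b ab.
rewrite /result -/b simE code_stringE.
(* The stuck case would exhibit an actual answer longer than the final bound, against [sb]. *)
case: dich => [[-> _] //|[s0 [s2 [es lt _]]]].
by move: sb; rewrite es all_cat /= leqNgt lt andbF.
Qed.

Fixpoint curry_code (k : nat) : (str -> str) -> den (ary k) :=
  match k return (str -> str) -> den (ary k) with
  | 0 => fun h => h [::]
  | k'.+1 => fun h a => curry_code k' (fun z => h (pair_str a z))
  end.

Lemma apply_curry_code k h (a : k.-tuple str) :
  apply_ary (curry_code k h) a = h (tuple_code a).
Proof.
elim: k h a => [|k IHk] h a; first by rewrite tuple0.
by rewrite /= IHk; case/tupleP: a => x a /=; rewrite theadE.
Qed.

Lemma apply_ary_inj k (f g : den (ary k)) : apply_ary f =1 apply_ary g -> f = g.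
Proof.
elim: k f g => [|k IHk] f g fg; first exact: (fg [tuple]).
apply: functional_extensionality => x; apply: IHk => a.
have := fg [tuple of x :: a]; rewrite /= theadE.
by have -> : behead_tuple [tuple of x :: a] = a by apply: val_inj.
Qed.

Lemma def_curry_code X (bX : basic_closed X) k G (h : env G -> str -> str) :
  definable X (t := Arr Base Base) h ->
  definable X (t := ary k) (fun e => curry_code k (h e)).
Proof.
elim: k G h => [|k IHk] G h Dh /=; first exact: (def_call Dh (def_nil bX G)).
apply: (@definable_lam X G Base (ary k)).
apply: (IHk (Base :: G) (fun e z => h e.2 (pair_str e.1 z))); apply: definable_lam.
apply: (def_call (definable_wk Base (definable_wk Base Dh))).
exact: (def_pair bX (definable_wk Base (definable_var0 X G Base))
  (definable_var0 X (Base :: G) Base)).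
Qed.

Lemma size_nth_tuple_code s i : size (nth [::] s i) <= size (tuple_code s).
Proof.
elim: s i => [|a s IHs] [|i] //=; rewrite size_pair_str -addnn; first lia.
by have := IHs i; lia.
Qed.

(** The packed arguments form one string that is also the length bound. No answer of the constantly
    empty oracle exceeds it, so a single simulation is complete. *)
Lemma FP_lambda X k (f : den (ary k.+1)) :
  basic_closed X -> lambda X (limrec : den limrec_ty) -> FP f -> lambda X f.
Proof.
move=> bX lX [M [p [Mfree MP]]]; have [g [Dg gP]] := def_poly bX p.
pose arg (i : 'I_k.+1) z := fst_str (iter i snd_str z).
pose h z := code_string (M := M) (out_tape _ _)
  (simulate M (fun=> [::]) [tuple arg i z | i < k.+1] z (g z)).
suff -> : f = curry_code k.+1 h.
  apply: (@definable_lambda X (ary k)).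
  apply: (def_curry_code bX k.+1 (G := [::]) (h := fun=> h)); apply: definable_lam.
  have Dz := definable_var0 X [::] Base.
  apply: def_code_string => //; apply: def_simulate => //; last exact: Dg.
    by apply: definable_lam; exact: def_nil.
  by move=> i; apply: def_fst => //; elim: (i : nat) => //= n IHn; apply: def_snd.
apply: apply_ary_inj => a; rewrite apply_curry_code.
have argE : [tuple arg i (tuple_code a) | i < k.+1] = a.
  apply: eq_from_tnth => i; rewrite tnth_mktuple /arg nth_tuple_code ?size_tuple //.
  by rewrite (tnth_nth [::]).
have size_a i : size (tnth a i) <= size (tuple_code a).
  by rewrite (tnth_nth [::]) size_nth_tuple_code.
have [t [d [hrun <- tp]]] := MP a.
rewrite /h argE simulateE // code_stringE.
have hrun' := run_oracle_free (cut_oracle (fun=> [::]) (tuple_code a)) Mfree hrun.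
have tg : t <= size (g (tuple_code a)).
  apply: leq_trans (gP _); apply: leq_trans tp _; apply: horner_homo.
  exact/bigmax_leqP.
by case: (bounded_stepP hrun' tg) => [[-> _ _] | []].
Qed.

(** * Transducers *)

Local Notation bit_symbol := (bool + void)%type.

Definition cells (a : str) : seq (option bit_symbol) := [seq Some (inl b) | b <- a].

Definition read_cell (x : option bit_symbol) : option bool :=
  if x is Some (inl b) then Some b else None.

Definition move_head (u : tape bit_symbol) (d : dir) : tape bit_symbol :=
  write_move u (scanned u) d.

Section Transducer.
Variables (Q : finType) (q0 : Q).
Variable step : Q -> option bool -> option bool -> option (Q * (dir * dir) * option bool).

Inductive transduces : Q -> tape bit_symbol -> tape bit_symbol -> nat -> str -> Prop :=
  | TransHalt q u v :
      step q (read_cell (scanned u)) (read_cell (scanned v)) = None ->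
      transduces q u v 0 [::]
  | TransStep q u v q' d d' x n o :
      step q (read_cell (scanned u)) (read_cell (scanned v)) = Some (q', (d, d'), x) ->
      transduces q' (move_head u d) (move_head v d') n o ->
      transduces q u v n.+1 (oapp (cons^~ [::]) [::] x ++ o).

Lemma size_transduces q u v n o : transduces q u v n o -> size o <= n.
Proof. by elim=> // {}q {}u {}v q' d d' [x|] m o' _ _ IH //=; exact: leqW. Qed.

Section Machine.
Variables (k : nat) (asks : bool) (ta tb : tape_id k 0).
Hypotheses (ta_out : ta != out_tape k 0) (tb_out : tb != out_tape k 0) (tab : ta != tb).
Local Notation out := (out_tape k 0).

(* Control states: [inr None] asks the oracle (on the empty query) before starting,
   [inr (Some false)] rewinds the output head and [inr (Some true)] halts. *)
Definition transducer_delta (q : Q + option bool)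
    (x : {ffun tape_id k 0 -> option bit_symbol}) : instr k 0 (Q + option bool) bit_symbol :=
  match q with
  | inl q => match step q (read_cell (x ta)) (read_cell (x tb)) with
     | Some (q', (d, d'), o) => Move (inl q')
         [ffun i => if i == out then if o is Some b then (Some (inl b), GoRight) else (x i, Stay)
                    else (x i, if i == ta then d else if i == tb then d' else Stay)]
     | None => Move (inr (Some false)) [ffun i => (x i, if i == out then GoLeft else Stay)]
     end
  | inr None => if asks then Ask _ _ _ (inl q0) else Halt _ _ _ _
  | inr (Some false) => if x out is Some _
     then Move (inr (Some false)) [ffun i => (x i, if i == out then GoLeft else Stay)]
     else Move (inr (Some true)) [ffun i => (x i, if i == out then GoRight else Stay)]
  | inr (Some true) => Halt _ _ _ _
  end.

Definition transducer : machine k :=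
  @Machine k (Q + option bool)%type void 0 (if asks then inr None else inl q0) transducer_delta.

Implicit Type c : config transducer.

Lemma bits_cells o r : head None r = None -> @bits k transducer (cells o ++ r) = o.
Proof. by move=> hr; elim: o => [|b o IHo] /=; [case: r hr => [|[]] | rewrite IHo]. Qed.

(** Outputs are read from the head, which must return to the first bit. It stands on the last bit of
    [o1] or, when [o1] is empty, on the blank that stops it. *)
Lemma rewind_run phi o1 o2 r c :
  cstate c = inr (Some false) -> head None r = None ->
  ctape c out = Tape (behead (cells (rev o1))) (head None (cells (rev o1)) :: cells o2 ++ r) ->
  exists2 d, run phi c (size o1).+1 [::] d & output d = o1 ++ o2.
Proof.
elim/last_ind: o1 o2 c => [|o1 b IH] o2 c cq hr cout.
  pose c' := @moved _ transducer c (inr (Some true))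
    [ffun i => (scanned (ctape c i), if i == out then GoRight else Stay)].
  exists c'; last by rewrite /output /tape_string /= ffunE eqxx cout /= bits_cells.
  apply: RunMove; last exact: RunHalt.
  rewrite /current_instr cq /= ffunE cout /=; congr Move.
  by apply/ffunP => i; rewrite !ffunE.
rewrite size_rcons cat_rcons.
pose c' := @moved _ transducer c (inr (Some false))
    [ffun i => (scanned (ctape c i), if i == out then GoLeft else Stay)].
have [||d hd od] := IH (b :: o2) c' _ hr; last 1 first.
- exists d => //; apply: RunMove hd.
  rewrite /current_instr cq /= ffunE cout rev_rcons /=; congr Move.
  by apply/ffunP => i; rewrite !ffunE.
- by [].
by rewrite /= ffunE eqxx cout rev_rcons.
Qed.

(** The time consists of the [n] transducer steps, one turn, and the rewind over the output and the
    blank before it. *)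
Lemma transducer_run phi q u v n o c o1 r :
  transduces q u v n o ->
  cstate c = inl q -> ctape c ta = u -> ctape c tb = v ->
  ctape c out = Tape (cells (rev o1)) r -> head None r = None -> behead r = [::] ->
  exists2 d, run phi c (n + (size (o1 ++ o)).+2) [::] d & output d = o1 ++ o.
Proof.
move=> h; elim: h c o1 r => {q u v n o} [q u v hs|q u v q' du dv x n o hs _ IH] c o1 r cq cu cv cout hr br.
  pose c' := @moved _ transducer c (inr (Some false))
    [ffun i => (scanned (ctape c i), if i == out then GoLeft else Stay)].
  have [||d hd od] := @rewind_run phi o1 [::] (None :: behead r) c' _ erefl; last 1 first.
  - rewrite cats0 in od *; exists d => //; apply: RunMove hd.
    rewrite /current_instr cq /= !ffunE cu cv hs; congr Move.
    by apply/ffunP => i; rewrite !ffunE.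
  - by [].
  by rewrite /= ffunE eqxx cout /= /scanned /= hr.
pose f := [ffun i => if i == out then
    if x is Some b then (Some (inl b : bit_symbol), GoRight) else (scanned (ctape c i), Stay)
  else (scanned (ctape c i), if i == ta then du else if i == tb then dv else Stay)].
pose c' := @moved _ transducer c (inl q') f.
pose o2 := o1 ++ oapp (cons^~ [::]) [::] x.
have [||||||d hd od] := IH c' o2 (if x is Some _ then behead r else None :: behead r).
- by [].
- by rewrite /= ffunE (negPf ta_out) eqxx cu.
- by rewrite /= ffunE (negPf tb_out) eq_sym (negPf tab) eqxx cv.
- rewrite /= ffunE eqxx /o2 cout; case: x {hs f c' o2} => [b|] /=.
    by rewrite cats1 rev_rcons.
  by rewrite cats0 /scanned /= hr.
- by case: (x) => //=; rewrite br.
- by case: (x) => //=; rewrite br.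
rewrite catA -/o2; exists d => //; apply: RunMove hd.
rewrite /current_instr cq /= !ffunE cu cv hs; congr Move.
by apply/ffunP => i; rewrite !ffunE.
Qed.

End Machine.
End Transducer.

Lemma quadratic_poly C : exists p : {poly nat}, forall m, (p.[m])%R = C * m.+1 ^ 2.
Proof.
exists ((C%:P * 'X + (2 * C)%N%:P) * 'X + C%:P)%R => m.
rewrite !hornerMXaddC hornerC /= -[RHS]/(C * (m.+1 * m.+1)).
change ((C * m + 2 * C) * m + C = C * (m.+1 * m.+1)); lia.
Qed.

(** The quadratic allowance is for the multiplication of lengths; the other elementary functions
    take linear time. *)
Definition transducible (f : den binary) : Prop :=
  exists (Q : finType) (q0 : Q)
    (step : Q -> option bool -> option bool -> option (Q * (dir * dir) * option bool)),
  forall a b, exists2 n, transduces step q0 (Tape [::] (cells a)) (Tape [::] (cells b)) n (f a b)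
    & n <= 4 * (maxn (size a) (size b)).+1 ^ 2.

Lemma transducible_FP f : transducible f -> @FP 2 f.
Proof.
(* The coefficient is 4 for the transduction, 4 for rewinding an output no longer than it, and 2 for
   the remaining steps. *)
move=> [Q [q0 [step fP]]]; have [p pE] := quadratic_poly 10.
pose ta := @in_tape 2 0 ord0; pose tb := @in_tape 2 0 ord_max.
exists (transducer q0 step false ta tb), p; split.
  move=> [q|[[]|]] x q' //=; last by case: (x _).
  by case: (step _ _ _) => [[[? []]]|].
move=> a; have [n h nb] := fP (tnth a ord0) (tnth a ord_max).
have [d hd od] := @transducer_run Q q0 step 2 false ta tb isT isT isT (fun=> [::]) _ _ _ _ _
  (init (transducer q0 step false ta tb) a) [::] [::] h erefl erefl erefl erefl erefl erefl.
exists (n + (size (f (tnth a ord0) (tnth a ord_max))).+2), d; split=> //.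
  rewrite od /=; congr (f _ _).
  by rewrite /thead (tnth_nth [::]) (tnth_nth [::]) nth_behead.
apply: leq_trans (horner_homo p (_ : maxn (size (tnth a ord0)) (size (tnth a ord_max)) <= _)).
  by have := size_transduces h; rewrite pE; move: nb; rewrite !expnS; lia.
by rewrite geq_max !(leq_bigmax (F := fun i => size (tnth a i))).
Qed.

(** The single query is empty, so the oracle merely carries one string, and its answer causes at
    most one revision. The oracle call raises the coefficient to 11. *)
Lemma transducible_SPT f : transducible f -> SPT (fun phi b => f (phi [::]) b).
Proof.
move=> [Q [q0 [step fP]]]; have [p pE] := quadratic_poly 11.
pose ta := answer_tape 1 0; pose tb := @in_tape 1 0 ord0.
pose T := transducer q0 step true ta tb; exists T, p, 1 => phi b.
have [n h nb] := fP (phi [::]) b.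
pose c := @answered _ T (init T [tuple b]) (inl q0) (phi [::]).
have [d hd od] := @transducer_run Q q0 step 1 true ta tb isT isT isT phi _ _ _ _ _
  c [::] [::] h erefl erefl erefl erefl erefl erefl.
exists (n + (size (f (phi [::]) b)).+2).+1, [:: phi [::]], d; split=> //.
- exact: (@RunAsk 1 T phi (init T [tuple b]) (inl q0) _ [::] d erefl hd).
- have := size_transduces h; rewrite pE /max_length big_seq1 maxnC.
  by move: nb; rewrite !expnS; lia.
by rewrite /=; case: ltnP.
Qed.

(** * One-way transducers *)

Section OneWay.
Variable Q : finType.
Variable step : Q -> option bool -> option bool -> option (Q * (bool * bool) * option bool).

Inductive scans : Q -> str -> str -> nat -> str -> Prop :=
  | ScanHalt q a b : step q (ohead a) (ohead b) = None -> scans q a b 0 [::]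
  | ScanStep q a b q' d d' x n o :
      step q (ohead a) (ohead b) = Some (q', (d, d'), x) ->
      scans q' (if d then behead a else a) (if d' then behead b else b) n o ->
      scans q a b n.+1 (oapp (cons^~ [::]) [::] x ++ o).

Lemma scan_emit q a b q' d d' x n o :
  step q (ohead a) (ohead b) = Some (q', (d, d'), Some x) ->
  scans q' (if d then behead a else a) (if d' then behead b else b) n o ->
  scans q a b n.+1 (x :: o).
Proof. by move=> hs h; exact: (ScanStep hs h). Qed.

Lemma scan_skip q a b q' d d' n o :
  step q (ohead a) (ohead b) = Some (q', (d, d'), None) ->
  scans q' (if d then behead a else a) (if d' then behead b else b) n o ->
  scans q a b n.+1 o.
Proof. by move=> hs h; exact: (ScanStep hs h). Qed.

Definition advance (d : bool) : dir := if d then GoRight else Stay.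

Definition one_way_step q x y :=
  if step q x y is Some (q', (d, d'), o) then Some (q', (advance d, advance d'), o) else None.

(** A head staying beyond the end of its word writes an explicit blank there, hence the trailing
    blanks. *)
Definition holds (u : tape bit_symbol) (a : str) :=
  exists m, tright u = cells a ++ nseq m None.

Lemma read_holds u a : holds u a -> read_cell (scanned u) = ohead a.
Proof. by case=> m; rewrite /scanned => ->; case: a => //; case: m. Qed.

Lemma holds_advance u a d :
  holds u a -> holds (move_head u (advance d)) (if d then behead a else a).
Proof.
case=> m hu; case: d; rewrite /holds /= /scanned hu; case: a hu => [|x a] _ /=.
- by exists m.-1; case: m.
- by exists m.
- by exists m.-1.+1; case: m.
by exists m.
Qed.

Lemma scans_transduces q a b n o u v :
  scans q a b n o -> holds u a -> holds v b -> transduces one_way_step q u v n o.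
Proof.
move=> h; elim: h u v => {q a b n o} [q a b hs|q a b q' d d' x n o hs _ IH] u v ua vb.
  by apply: TransHalt; rewrite (read_holds ua) (read_holds vb) /one_way_step hs.
apply: (TransStep (q' := q') (d := advance d) (d' := advance d')).
  by rewrite (read_holds ua) (read_holds vb) /one_way_step hs.
by apply: IH; apply: holds_advance.
Qed.

Lemma scans_copy_left q a b :
  (forall y, step q None y = None) ->
  (forall x y, step q (Some x) y = Some (q, (true, false), Some x)) ->
  scans q a b (size a) a.
Proof.
move=> h0 h1; elim: a => [|x a IHa]; first exact: ScanHalt.
by apply: scan_emit; [exact: h1 | exact: IHa].
Qed.

Lemma scans_copy_right q a b :
  step q (ohead a) None = None ->
  (forall y, step q (ohead a) (Some y) = Some (q, (false, true), Some y)) ->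
  scans q a b (size b) b.
Proof.
move=> h0 h1; elim: b => [|y b IHb]; first exact: ScanHalt.
by apply: scan_emit; [exact: h1 | exact: IHb].
Qed.

End OneWay.

Lemma one_way_transducible (Q : finType) (q0 : Q)
    (step : Q -> option bool -> option bool -> option (Q * (bool * bool) * option bool))
    (f : den binary) :
  (forall a b, exists2 n, scans step q0 a b n (f a b) & n <= (size a).*2 + size b + 2) ->
  transducible f.
Proof.
move=> fP; exists Q, q0, (one_way_step step) => a b; have [n h nb] := fP a b; exists n.
  by apply: (scans_transduces h); exists 0; rewrite cats0.
by apply: leq_trans nb _; rewrite -muln2 !expnS; lia.
Qed.

(** * Transducers for the elementary functions *)

Lemma transducible_bit x : transducible (fun _ _ => [:: x]).
Proof.
apply: (@one_way_transducible bool false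
  (fun q _ _ => if q then None else Some (true, (false, false), Some x))) => a b.
exists 1; last by lia.
by apply: scan_emit; [exact: erefl | apply: ScanHalt].
Qed.

Lemma transducible_cat : transducible (fun a b => a ++ b).
Proof.
apply: (@one_way_transducible unit tt (fun _ x y => match x, y with
  | Some x, _ => Some (tt, (true, false), Some x)
  | None, Some y => Some (tt, (false, true), Some y)
  | None, None => None end)) => a b.
exists (size a + size b); last by rewrite -muln2; lia.
elim: a => [|x a IHa]; first exact: scans_copy_right.
by apply: scan_emit; [exact: erefl | exact: IHa].
Qed.

Lemma transducible_gate x : transducible (fun a b => if head false a == x then b else [::]).
Proof.
apply: (@one_way_transducible bool false (fun q u y =>
  if q then omap (fun y => (true, (false, true), Some y)) y
  else if odflt false u == x then Some (true, (false, false), None) else None)) => a b.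
have -> : head false a = odflt false (ohead a) by case: a.
case: ifP => ax; last first.
  by exists 0 => //; apply: ScanHalt; rewrite /= ax.
exists (size b).+1; last by lia.
apply: (scan_skip (q' := true) (d := false) (d' := false)); first by rewrite /= ax.
exact: scans_copy_right.
Qed.

Lemma transducible_behead : transducible (fun a _ => behead a).
Proof.
apply: (@one_way_transducible bool false (fun q x _ =>
  if q then omap (fun x => (true, (true, false), Some x)) x
  else Some (true, (true, false), None))) => a b.
exists (size (behead a)).+1; last by rewrite size_behead -muln2; lia.
apply: (scan_skip (q' := true) (d := true) (d' := false)) => //.
exact: scans_copy_left.
Qed.

Lemma transducible_take : transducible (fun a b => take (size a) b).
Proof.
apply: (@one_way_transducible unit tt (fun _ x y => match x, y with
  | Some _, Some y => Some (tt, (true, true), Some y)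
  | _, _ => None end)) => a b.
exists (minn (size a) (size b)); last by rewrite -muln2; lia.
elim: a b => [|x a IHa] [|y b]; rewrite ?minn0 ?min0n /=; try exact: ScanHalt.
rewrite minnSS; by apply: scan_emit; [exact: erefl | exact: (IHa b)].
Qed.

Lemma transducible_drop : transducible (fun a b => drop (size a) b).
Proof.
apply: (@one_way_transducible unit tt (fun _ x y => match x, y with
  | Some _, _ => Some (tt, (true, true), None)
  | None, Some y => Some (tt, (false, true), Some y)
  | None, None => None end)) => a b.
exists (size a + (size b - size a)); last by rewrite -muln2; lia.
elim: a b => [|x a IHa] b.
  by rewrite drop0 subn0; apply: scans_copy_right.
have -> : drop (size (x :: a)) b = drop (size a) (behead b) by rewrite -drop1 drop_drop addn1.
have -> : size (x :: a) + (size b - size (x :: a)) = (size a + (size (behead b) - size a)).+1.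
  by rewrite size_behead /=; lia.
by apply: scan_skip; [exact: erefl | exact: (IHa (behead b))].
Qed.

Lemma transducible_pair : transducible pair_str.
Proof.
(* [Some false] emits the mark before a bit and [Some true] the bit; after the first input the mark
   [false] is emitted and [None] copies the second. *)
apply: (@one_way_transducible (option bool) (Some false) (fun q x y => match q, x, y with
  | Some false, Some _, _ => Some (Some true, (false, false), Some true)
  | Some true, Some x, _ => Some (Some false, (true, false), Some x)
  | Some _, None, _ => Some (None, (false, false), Some false)
  | None, _, Some y => Some (None, (false, true), Some y)
  | None, _, None => None end)) => a b.
exists ((size a).*2 + (size b).+1); last by lia.
elim: a => [|x a IHa].
  by apply: scan_emit; [exact: erefl | apply: scans_copy_right].
by apply: scan_emit; [exact: erefl | apply: scan_emit; [exact: erefl | exact: IHa]].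
Qed.

(* [fst_str] and [snd_str] recurse on a string two bits at a time. *)
Lemma str_ind2 (P : str -> Prop) :
  P [::] -> (forall x, P [:: x]) -> (forall x y z, P z -> P [:: x, y & z]) -> forall z, P z.
Proof.
move=> P0 P1 P2 z; suff: P z /\ forall x, P (x :: z) by case.
by elim: z => [|y z [IH1 IH2]]; split=> // x; apply: P2.
Qed.

Lemma transducible_fst : transducible (fun a _ => fst_str a).
Proof.
apply: (@one_way_transducible bool false (fun q x _ => match q, x with
  | false, Some true => Some (true, (true, false), None)
  | true, Some x => Some (false, (true, false), Some x)
  | _, _ => None end)) => a b.
set step := (X in scans X).
suff [n h nb] : exists2 n, scans step false a b n (fst_str a) & n <= size a.
  by exists n => //; rewrite -muln2; lia.
elim/str_ind2: a => [|[]|[] x a [n h nb]] /=; try by exists 0 => //; apply: ScanHalt.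
  by exists 1 => //; apply: scan_skip; [exact: erefl | apply: ScanHalt].
exists n.+2 => //.
by apply: scan_skip; [exact: erefl | apply: scan_emit; [exact: erefl | exact: h]].
Qed.

Lemma transducible_snd : transducible (fun a _ => snd_str a).
Proof.
apply: (@one_way_transducible (option bool) (Some false) (fun q x _ => match q, x with
  | Some false, Some true => Some (Some true, (true, false), None)
  | Some false, Some false => Some (None, (true, false), None)
  | Some true, Some _ => Some (Some false, (true, false), None)
  | None, Some x => Some (None, (true, false), Some x)
  | _, None => None end)) => a b.
set step := (X in scans X).
suff [n h nb] : exists2 n, scans step (Some false) a b n (snd_str a) & n <= size a.
  by exists n => //; rewrite -muln2; lia.
elim/str_ind2: a => [|[]|[] x a [n h nb]] /=; try by exists 0 => //; apply: ScanHalt.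
- by exists 1 => //; apply: scan_skip; [exact: erefl | apply: ScanHalt].
- by exists 1 => //; apply: scan_skip; [exact: erefl | apply: ScanHalt].
- exists n.+2 => //; by apply: scan_skip; [exact: erefl | apply: scan_skip; [exact: erefl | exact: h]].
exists (size a).+2 => //; apply: scan_skip; first exact: erefl.
by apply: (@scans_copy_left _ step None (x :: a)).
Qed.

Lemma transducible_read_bits : transducible read_bits.
Proof.
apply: (@one_way_transducible unit tt (fun _ x y => match x, y with
  | Some x, Some y => if x || y then Some (tt, (true, true), Some x) else None
  | _, _ => None end)) => a b.
set step := (X in scans X).
suff [n h nb] : exists2 n, scans step tt a b n (read_bits a b) & n <= size a.
  by exists n => //; rewrite -muln2; lia.
elim: a b => [|x a IHa] [|y b] /=; try by exists 0 => //; apply: ScanHalt.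
case xy: (x || y); last by exists 0 => //; apply: ScanHalt; rewrite /= xy.
have [n h nb] := IHa b; exists n.+1 => //.
apply: (scan_emit (q' := tt) (d := true) (d' := true)) => //.
by rewrite /= xy.
Qed.

Lemma transducible_map h : transducible (fun a _ => map h a).
Proof.
apply: (@one_way_transducible unit tt (fun _ x _ =>
  omap (fun x => (tt, (true, false), Some (h x))) x)) => a b.
exists (size a); last by rewrite -muln2; lia.
elim: a => [|x a IHa]; first exact: ScanHalt.
by apply: scan_emit; [exact: erefl | exact: IHa].
Qed.

(** For each symbol of the first input, state [false] sweeps the second one emitting [true] at every
    bit, and state [true] walks back to the blank before it. *)
Definition smash_step (q : bool) (x y : option bool) : option (bool * (dir * dir) * option bool) :=
  match q, x, y with
  | false, None, _ => None
  | false, Some _, Some _ => Some (false, (Stay, GoRight), Some true)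
  | false, Some _, None => Some (true, (GoRight, GoLeft), None)
  | true, _, Some _ => Some (true, (Stay, GoLeft), None)
  | true, _, None => Some (false, (Stay, GoRight), None)
  end.

Lemma smash_sweep x a b1 b2 l m n o :
  (forall u, holds u (x :: a) -> transduces smash_step false u
     (Tape (cells (rev (b1 ++ b2)) ++ l) (nseq m None)) n o) ->
  forall u, holds u (x :: a) -> transduces smash_step false u
     (Tape (cells (rev b1) ++ l) (cells b2 ++ nseq m None)) (size b2 + n) (nseq (size b2) true ++ o).
Proof.
elim: b2 b1 => [|y b2 IH] b1 h u hu; first by rewrite cats0 in h; exact: h.
apply: (TransStep (q' := false) (d := Stay) (d' := GoRight) (x := Some true)).
  by rewrite (read_holds hu).
have := IH (rcons b1 y); rewrite cat_rcons rev_rcons => /(_ h); apply.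
exact: (holds_advance false hu).
Qed.

Lemma smash_rewind a b1 b2 l m n o :
  head None l = None -> behead l = [::] ->
  (forall u, holds u a -> transduces smash_step false u
     (Tape [:: None] (cells (b1 ++ b2) ++ nseq m None)) n o) ->
  forall u, holds u a -> transduces smash_step true u
     (Tape (behead (cells (rev b1) ++ l))
           (head None (cells (rev b1) ++ l) :: cells b2 ++ nseq m None)) ((size b1).+1 + n) o.
Proof.
move=> hl bl; elim/last_ind: b1 b2 => [|b1 y IH] b2 h u hu.
  apply: (TransStep (q' := false) (d := Stay) (d' := GoRight) (x := None)).
    by rewrite /= hl.
  by rewrite /= /move_head /= bl hl; exact/h/(holds_advance false hu).
rewrite size_rcons rev_rcons.
apply: (TransStep (q' := true) (d := Stay) (d' := GoLeft) (x := None)).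
  by [].
by apply: (IH (y :: b2)); [rewrite -cat_rcons | exact: (holds_advance false hu)].
Qed.

Lemma transducible_smash : transducible (fun a b => nseq (size a * size b) true).
Proof.
exists bool, false, smash_step => a b.
exists (size a * ((size b).*2 + 2)); last by rewrite -muln2 !expnS; nia.
suff h u l m : holds u a -> head None l = None -> behead l = [::] ->
    transduces smash_step false u (Tape l (cells b ++ nseq m None))
      (size a * ((size b).*2 + 2)) (nseq (size a * size b) true).
  by rewrite -[cells b]cats0; apply: (h _ _ 0) => //; exists 0; rewrite cats0.
elim: a u l m => [|x a IHa] u l m hu hl bl.
  by apply: TransHalt; rewrite (read_holds hu).
(* One symbol costs a sweep, a turn, and a way back that includes the blank before the word. *)
have -> : size (x :: a) * ((size b).*2 + 2)
    = size b + ((size b).+1 + size a * ((size b).*2 + 2)).+1 by rewrite /= -muln2; lia.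
rewrite /= mulSn nseqD.
apply: (@smash_sweep x a [::]) hu => {}u hu.
apply: (TransStep (q' := true) (d := GoRight) (d' := GoLeft) (x := None)).
  by rewrite (read_holds hu) /=; case: m.
have := @smash_rewind a b [::] l m.-1.+1 _ _ hl bl; rewrite cats0 => hr.
(* The rewind leaves an explicit blank left of the word; the induction therefore admits this shape
   of [l] besides the empty one. *)
have {}hr := hr _ _ (fun v hv => IHa v [:: None] m.-1.+1 hv erefl erefl).
by case: m hu hr => [|m] hu; apply; exact: (holds_advance true hu).
Qed.

Lemma basic_transducible f : basic f -> transducible f.
Proof.
case=> [x||x||||||||h|].
- exact: transducible_bit.
- exact: transducible_cat.
- exact: transducible_gate.
- exact: transducible_behead.
- exact: transducible_take.
- exact: transducible_drop.
- exact: transducible_pair.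
- exact: transducible_fst.
- exact: transducible_snd.
- exact: transducible_read_bits.
- exact: transducible_map.
exact: transducible_smash.
Qed.

Lemma FP_basic_closed : basic_closed (cup_class FP_class limrec_class).
Proof.
move=> f /basic_transducible/transducible_FP FPf.
by exists (Cst [::] (or_introl (FP_const FPf) : cup_class _ _ (f : den (ary 2)))).
Qed.

(** The first argument is handed to the operator as a constant oracle. *)
Lemma SPT_basic_closed : basic_closed SPT_class.
Proof.
move=> f /basic_transducible/transducible_SPT Ff.
exists (Lam (Lam (App (App (Cst [:: Base; Base] (SPT_const Ff))
  (Lam (Var SPT_class (VarS Base (VarS Base (VarZ [::] Base))))))
  (Var SPT_class (VarZ [:: Base] Base))))).
by apply: functional_extensionality => a; apply: functional_extensionality.
Qed.

(** * The oracle iterator *)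

Fixpoint guarded_iter (phi : str -> str) (n : nat) (first : bool) (y : str) : str :=
  if n is n'.+1 then
    if first || (size (phi y) <= size y) then guarded_iter phi n' false (phi y) else [::]
  else y.

(* Iterates the oracle from the empty string, once per input bit. Only the first
   answer may be long: giving up on any later increase keeps the length revisions
   bounded. *)
Definition iterator (phi : str -> str) (x : str) : str :=
  guarded_iter phi (size x) true [::].

Section Iterator.
Local Notation tin := (@in_tape 1 0 ord0).
Local Notation out := (out_tape 1 0).
Local Notation qry := (query_tape 1 0).
Local Notation ans := (answer_tape 1 0).

(* Control states: [Some (false, f)] starts a round, [Some (true, f)] copies the
   answer to the output and query tapes, [None] rewinds these two tapes; [f] tells
   whether this is the first round. *)
Definition iterator_delta (q : option (bool * bool))
    (x : {ffun tape_id 1 0 -> option bit_symbol}) :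
    instr 1 0 (option (bool * bool)) bit_symbol :=
  match q with
  | Some (false, f) =>
      if read_cell (x tin) is Some _ then Ask _ _ _ (Some (true, f)) else Halt _ _ _ _
  | Some (true, f) =>
      if read_cell (x ans) is Some b then
        if f || read_cell (x out) then Move (Some (true, f))
          [ffun i => if (i == out) || (i == qry) then (Some (inl b), GoRight)
                     else (x i, if i == ans then GoRight else Stay)]
        else Halt _ _ _ _
      else Move None [ffun i => if (i == out) || (i == qry) then (None, GoLeft) else (x i, Stay)]
  | None =>
      if read_cell (x qry) is Some _ then
        Move None [ffun i => (x i, if (i == out) || (i == qry) then GoLeft else Stay)]
      else Move (Some (false, false))
        [ffun i => (x i, if [|| i == out, i == qry | i == tin] then GoRight else Stay)]
  end.

Definition iterator_machine : machine 1 :=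
  @Machine 1 (option (bool * bool)) void 0 (Some (false, true)) iterator_delta.

Implicit Type c : config iterator_machine.

(** Reachability without oracle calls, in continuation form so that segments compose directly with
    [run]. *)
Definition leads phi c n c' :=
  forall t s d, run phi c' t s d -> run phi c (n + t) s d.

Lemma leads_move phi c q f n c' :
  current_instr c = Move q f -> leads phi (moved c q f) n c' -> leads phi c n.+1 c'.
Proof. by move=> ci h t s d /h; apply: RunMove. Qed.

(** A rewinding head stops on the blank to the left; behind its first blank, [r] may keep leftovers
    of an earlier, longer word. *)
Definition word_tape (u : tape bit_symbol) (y : str) :=
  exists l r, [/\ u = Tape l (cells y ++ r), head None l = None, behead l = [::]
                & head None r = None].

(** The current value [y] is at once the next query, the output in case of halting, and the
    yardstick for the next answer. *)
Definition round_start c x y :=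
  [/\ cstate c = Some (false, false), holds (ctape c tin) x, word_tape (ctape c out) y
    & word_tape (ctape c qry) y].

Lemma iterator_rewind phi z1 z2 lo lq ro rq x c :
  head None lo = None -> behead lo = [::] -> head None lq = None -> behead lq = [::] ->
  head None ro = None -> head None rq = None ->
  cstate c = None -> holds (ctape c tin) x ->
  ctape c out = Tape (behead (cells (rev z1) ++ lo)) (head None (cells (rev z1) ++ lo) :: cells z2 ++ ro) ->
  ctape c qry = Tape (behead (cells (rev z1) ++ lq)) (head None (cells (rev z1) ++ lq) :: cells z2 ++ rq) ->
  exists2 c', round_start c' (behead x) (z1 ++ z2) & leads phi c (size z1).+1 c'.
Proof.
move=> hlo blo hlq blq hro hrq; elim/last_ind: z1 z2 c => [|z1 b IH] z2 c cq cin cout cqry.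
  pose c' := @moved _ iterator_machine c (Some (false, false))
    [ffun i => (scanned (ctape c i), if [|| i == out, i == qry | i == tin] then GoRight else Stay)].
  exists c'.
    split=> //=; rewrite ffunE /=.
    - exact: (holds_advance true cin).
    - by rewrite cout /= hlo blo; exists [:: None], ro.
    - by rewrite cqry /= hlq blq; exists [:: None], rq.
  apply: leads_move; last by move=> t s d; apply.
  rewrite /current_instr cq /= ffunE cqry /= hlq /=; congr Move.
  by apply/ffunP => i; rewrite !ffunE.
rewrite size_rcons cat_rcons.
pose c' := @moved _ iterator_machine c None
    [ffun i => (scanned (ctape c i), if (i == out) || (i == qry) then GoLeft else Stay)].
have [||||d hd ld] := IH (b :: z2) c'.
- by [].
- by rewrite /= ffunE; exact: (holds_advance false cin).
- by rewrite /= ffunE /= cout rev_rcons.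
- by rewrite /= ffunE /= cqry rev_rcons.
exists d => //; apply: leads_move ld.
rewrite /current_instr cq /= ffunE cqry rev_rcons /=; congr Move.
by apply/ffunP => i; rewrite !ffunE.
Qed.

Definition copy_config c (f : bool) (b : bool) : config iterator_machine :=
  @moved _ iterator_machine c (Some (true, f))
    [ffun i => if (i == out) || (i == qry) then (Some (inl b : bit_symbol), GoRight)
               else (scanned (ctape c i), if i == ans then GoRight else Stay)].

Lemma copy_instr c f b z :
  cstate c = Some (true, f) -> holds (ctape c ans) (b :: z) ->
  f || read_cell (scanned (ctape c out)) ->
  exists2 g, current_instr c = Move (Some (true, f) : state iterator_machine) g
    & moved c (Some (true, f) : state iterator_machine) g = copy_config c f b.
Proof.
move=> cq ca co; rewrite /current_instr cq /= !ffunE (read_holds ca) /= co.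
eexists; first by [].
by congr moved; apply/ffunP => i; rewrite !ffunE.
Qed.

(** Lengths are compared by overwriting: except in the first round, each new bit must land on a bit
    of the previous value on the output tape. The time covers the copy, a turn and the rewind. *)
Lemma iterator_copy phi f z1 z2 lo lq ro rq x c :
  head None lo = None -> behead lo = [::] -> head None lq = None -> behead lq = [::] ->
  cstate c = Some (true, f) -> holds (ctape c tin) x -> holds (ctape c ans) z2 ->
  ctape c out = Tape (cells (rev z1) ++ lo) ro ->
  ctape c qry = Tape (cells (rev z1) ++ lq) rq ->
  f \/ (exists y r, ro = cells y ++ r /\ size z2 <= size y) ->
  exists2 c', round_start c' (behead x) (z1 ++ z2)
    & leads phi c ((size z2).*2 + (size z1).+2) c'.
Proof.
move=> hlo blo hlq blq.
elim: z2 z1 ro rq c => [|b z2 IH] z1 ro rq c cq cin ca cout cqry cz.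
  (* The blank written at this turn ends the new word even when the overwritten one was longer. *)
  pose c' := @moved _ iterator_machine c None
    [ffun i => if (i == out) || (i == qry) then (None, GoLeft) else (scanned (ctape c i), Stay)].
  have [||||c2 c2P c2l] := @iterator_rewind phi z1 [::] lo lq (None :: behead ro)
      (None :: behead rq) x c' hlo blo hlq blq erefl erefl.
  - by [].
  - by rewrite /= ffunE; exact: (holds_advance false cin).
  - by rewrite /= ffunE /= cout.
  - by rewrite /= ffunE /= cqry.
  exists c2 => //; apply: leads_move c2l.
  rewrite /current_instr cq /= ffunE (read_holds ca) /=; congr Move.
  by apply/ffunP => i; rewrite !ffunE.
have co : f || read_cell (scanned (ctape c out)).
  rewrite cout; case: cz => [-> //|[[|y ys] [r [-> //=]]]] _.
  by rewrite orbT.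
have [g ci cg] := copy_instr cq ca co.
have [||||||c2 c2P c2l] := IH (rcons z1 b) (behead ro) (behead rq) (copy_config c f b).
- by [].
- by rewrite /= ffunE; exact: (holds_advance false cin).
- by rewrite /= ffunE; exact: (holds_advance true ca).
- by rewrite /= ffunE /= cout rev_rcons.
- by rewrite /= ffunE /= cqry rev_rcons.
- by case: cz => [|[[|y ys] [r [-> //= le]]]]; [left | right; exists ys, r].
rewrite cat_rcons in c2P; exists c2 => //.
rewrite -cg size_rcons in c2l *; have -> : (size (b :: z2)).*2 + (size z1).+2 = ((size z2).*2 + (size z1).+3).+1.
  by rewrite /= doubleS; lia.
exact: leads_move ci c2l.
Qed.

(** A longer answer runs out of old bits: the machine halts with the output head on the blank behind
    them, hence with empty output, as giving up demands. *)
Lemma iterator_abort phi z y l r c :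
  cstate c = Some (true, false) -> holds (ctape c ans) z ->
  ctape c out = Tape l (cells y ++ r) -> head None r = None -> size y < size z ->
  exists2 d, run phi c (size y) [::] d & output d = [::].
Proof.
elim: y z l c => [|x y IH] [|b z] l c cq ca cout hr // lt.
  exists c; last by rewrite /output cout /tape_string /=; case: r hr {cout} => [|[]].
  apply: RunHalt; rewrite /current_instr cq /= !ffunE (read_holds ca) /= cout /scanned.
  by case: r hr {cout} => [|[]].
have co : false || read_cell (scanned (ctape c out)) by rewrite cout.
have [g ci cg] := copy_instr cq ca co.
have [|||||d hd od] := IH z (Some (inl b) :: l) (copy_config c false b).
- by [].
- by rewrite /= ffunE; exact: (holds_advance true ca).
- by rewrite /= ffunE /= cout.
- by [].
- by [].
by exists d => //; rewrite -cg in hd; apply: RunMove ci hd.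
Qed.

(** Accepted answers after the first never exceed the current value, so only the first answer and
    one aborting answer can be revisions. A round costs the query, twice the answer for copying and
    rewinding, and two more steps. *)
Lemma iterator_run phi f x y c :
  cstate c = Some (false, f) -> holds (ctape c tin) x -> word_tape (ctape c out) y ->
  word_tape (ctape c qry) y ->
  exists t s d, [/\ run phi c t s d, output d = guarded_iter phi (size x) f y,
    t <= size x * ((\max_(b <- s) size b).*2 + 3) &
    forall N, size y <= N -> length_revisions N s <= f.+1].
Proof.
elim: x f y c => [|b x IH] f y c cq cin [lo [ro [cout hlo blo hro]]] [lq [rq [cqry hlq blq hrq]]].
  exists 0, [::], c; split=> //; last first.
    by rewrite /output cout; apply: (@bits_cells bool false (fun _ _ _ => None) 1 true out out).
  by apply: RunHalt; rewrite /current_instr cq /= ffunE (read_holds cin).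
pose z := phi y.
have qc : query c = y.
  by rewrite /query cqry; apply: (@bits_cells bool false (fun _ _ _ => None) 1 true out out).
pose c1 := @answered _ iterator_machine c (Some (true, f)) z.
have ci : current_instr c = Ask _ _ _ (Some (true, f)).
  by rewrite /current_instr cq /= ffunE (read_holds cin).
have c1a : holds (ctape c1 ans) z by exists 0; rewrite cats0.
have ask t s d : run phi c1 t s d -> run phi c t.+1 (z :: s) d.
  by have := @RunAsk _ _ phi c _ t s d ci; rewrite qc.
rewrite /=; case: ifP => fz.
  have fz' : f \/ exists y' r, cells y ++ ro = cells y' ++ r /\ size z <= size y'.
    by case/orP: fz => [->|le]; [left | right; exists y, ro].
  have [c2 [c2q c2in c2out c2qry] c2l] := @iterator_copy phi f [::] z lo lq (cells y ++ ro)
    (cells y ++ rq) (b :: x) c1 hlo blo hlq blq erefl cin c1a cout cqry fz'.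
  have [t [s [d [hd od td rd]]]] := IH _ _ _ c2q c2in c2out c2qry.
  exists ((size z).*2 + 2 + t).+1, (z :: s), d; split=> //.
  - exact/ask/c2l.
  - rewrite big_cons mulSn; set m := \max_(_ <- _) _ in td *.
    apply: (@leq_trans ((size z).*2 + 3 + size x * (m.*2 + 3))); first by lia.
    by rewrite leq_add ?leq_mul // leq_add2r leq_double ?leq_maxl ?leq_maxr.
  move=> N yN /=; have := rd (maxn N (size z)) (leq_maxr _ _).
  by case/orP: fz => [->|/leq_trans/(_ yN)]; rewrite -/z; case: ltnP; lia.
move/negbT: fz; rewrite negb_or -ltnNge => /andP[/negPf f0 lt].
have c1q : cstate c1 = Some (true, false) by rewrite /= f0.
have [d hd od] := @iterator_abort phi z y lo ro c1 c1q c1a cout hro lt.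
exists (size y).+1, [:: z], d; split=> //; first exact: ask.
  by rewrite big_seq1 mulSn -muln2; move: lt; rewrite -/z; lia.
by move=> N _ /=; rewrite f0; case: ltnP.
Qed.
End Iterator.

Lemma iterator_SPT : SPT iterator.
Proof.
have [p pE] := quadratic_poly 3.
exists iterator_machine, p, 2 => phi x.
have [||||t [s [d [hd od td rd]]]] := @iterator_run phi true x [::] (init _ [tuple x]).
- by [].
- by exists 0; rewrite cats0.
- by exists [::], [::].
- by exists [::], [::].
exists t, s, d; split=> //; last exact: rd.
rewrite pE /max_length; set m := \max_(_ <- _) _ in td *.
apply: leq_trans td _; apply: (@leq_trans (maxn (size x) m * ((maxn (size x) m).*2 + 3))).
  by rewrite leq_mul ?leq_maxl // leq_add2r leq_double leq_maxr.
by rewrite !expnS -muln2; nia.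
Qed.

(** * Limited recursion from the iterator *)

(** Both components end before position [n], so truncation cuts only into the padding. *)
Lemma pair_str_pad u y p n :
  (size u + size y).*2 + 2 <= n ->
  exists q, take n (pair_str u (pair_str y p)) = pair_str u (pair_str y q).
Proof.
move=> le; exists (take (n - ((size u + size y).*2 + 2)) p).
have padE : forall q, pair_str u (pair_str y q) = pair_str u (pair_str y [::]) ++ q.
  by move=> q; elim: u {le} => [|x u /= -> //]; rewrite /= -cat_cons; congr (_ :: _); elim: y => [|x y /= ->].
rewrite padE [RHS]padE take_cat !size_pair_str ltnNge.
have -> : (size u).*2 + ((size y).*2 + (size [::]).+1).+1 = (size u + size y).*2 + 2.
  by rewrite doubleD /=; lia.
by rewrite le.
Qed.

Section LimrecByIterator.
Variables (phi : str -> str -> str) (a b c : str).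

(* A state codes the part [u] of [c] already processed and the value [y] at [u];
   the padding gives every later state room within the length of the previous one. *)
Definition pad : str := c ++ c ++ b ++ b ++ [:: true].

(** The empty string is the iterator's starting value, and its successor codes the start of the
    recursion. Later steps are truncated to the length of [z], so the iterator never gives up. *)
Definition limrec_step (z : str) : str :=
  if size z < 1 then pair_str [::] (pair_str a pad)
  else if size (fst_str z) < size c then
    take (size z) (pair_str (take (size (true :: fst_str z)) c)
      (pair_str (take (size b) (phi (take (size (true :: fst_str z)) c) (fst_str (snd_str z)))) pad))
  else z.

Definition limrec_state i z :=
  i <= size c /\ size pad + 2 <= size z /\
  exists p, z = pair_str (take i c) (pair_str (limrec phi a b (take i c)) p).

Lemma limrec_stepP i z : limrec_state i z ->
  limrec_state (minn i.+1 (size c)) (limrec_step z) /\ size (limrec_step z) <= size z.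
Proof.
move=> [ic [zs [p ez]]]; rewrite /limrec_step ltnNge (leq_trans _ zs) ?addn2 //=.
have ->: fst_str (snd_str z) = limrec phi a b (take i c) by rewrite ez pair_strK2 pair_strK.
have ->: size (fst_str z) = i by rewrite ez pair_strK size_takel.
case: ltnP => [lt|ge]; last first.
  have -> : minn i.+1 (size c) = i by lia.
  by split=> //; split=> //; split=> //; exists p.
have -> : minn i.+1 (size c) = i.+1 by apply/minn_idPl.
have eL : take (size b) (phi (take i.+1 c) (limrec phi a b (take i c)))
    = limrec phi a b (take i.+1 c).
  by rewrite (take_nth false) // limrec_rcons.
rewrite eL; split; last by rewrite size_take; case: ltnP => // /ltnW.
split=> //; split.
  rewrite size_take; case: ifP => // _.
  by rewrite !size_pair_str; lia.
(* The new prefix is no longer than [c] and the new value no longer than [b]; the two copies of each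
   in the padding match the doubling in the pair code. *)
apply: pair_str_pad; rewrite -eL size_takel // size_take.
by move: zs; rewrite /pad !size_cat /= -muln2; case: ltnP; lia.
Qed.

Lemma limrec_iterator : limrec phi a b c = fst_str (snd_str (iterator limrec_step pad)).
Proof.
have iterP n i z : limrec_state i z ->
    limrec_state (minn (i + n) (size c)) (guarded_iter limrec_step n false z).
  elim: n i z => [|n IH] i z sz /=.
    by have [ic _] := sz; rewrite addn0 (minn_idPl ic).
  have [sz' ->] := limrec_stepP sz.
  have := IH _ _ sz'; congr limrec_state; lia.
have s0 : limrec_state 0 (limrec_step [::]).
  rewrite /limrec_step /limrec_state take0; split=> //; split; last by exists pad.
  by rewrite !size_pair_str /=; lia.
(* The first round only builds the initial state. At least [size c] rounds remain, and surplus ones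
   leave the final state unchanged. *)
have [_ [_ [p]]] := iterP (size pad).-1 _ _ s0.
rewrite /iterator; have -> : size pad = (size pad).-1.+1 by rewrite /pad !size_cat /=; lia.
rewrite /= => ->; rewrite pair_strK2 pair_strK take_oversize // leq_min leqnn andbT.
by rewrite /pad !size_cat /=; lia.
Qed.

End LimrecByIterator.

Lemma SPT_limrec : lambda SPT_class (limrec : den limrec_ty).
Proof.
have bX := SPT_basic_closed.
have -> : (limrec : den limrec_ty)
    = fun phi a b c => fst_str (snd_str (iterator (limrec_step phi a b c) (pad b c))).
  do 4![apply: functional_extensionality => ?]; exact: limrec_iterator.
apply: definable_lambda2; do 4!apply: definable_lam => /=.
pose G := [:: Base; Base; Base; binary].
have Dc : definable SPT_class (t := Base) (fun e : env G => e.1).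
  exact: definable_var0.
have Db : definable SPT_class (t := Base) (fun e : env G => e.2.1).
  exact: (definable_wk Base (definable_var0 _ [:: Base; binary] Base)).
have Da : definable SPT_class (t := Base) (fun e : env G => e.2.2.1).
  exact: (definable_wk Base (definable_wk Base (definable_var0 _ [:: binary] Base))).
have Dphi : definable SPT_class (t := binary) (fun e : env G => e.2.2.2.1).
  exact: (definable_wk Base (definable_wk Base (definable_wk Base (definable_var0 _ [::] binary)))).
have Dpad : definable SPT_class (t := Base) (fun e : env G => pad e.2.1 e.1).
  exact: (def_cat bX Dc (def_cat bX Dc (def_cat bX Db (def_cat bX Db (def_bit bX _ true))))).
have Dstep : definable SPT_class (t := Arr Base Base)
    (fun e : env G => limrec_step e.2.2.2.1 e.2.2.1 e.2.1 e.1).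
  apply: definable_lam.
  have Dz := definable_var0 SPT_class G Base.
  have Dfst := def_fst bX Dz.
  have Du := def_take bX (def_cat bX (def_bit bX _ true) Dfst) (definable_wk Base Dc).
  apply: def_if => //; first exact: (dec_lt_size bX Dz (def_bit bX _ true)).
    exact: (def_pair bX (def_nil bX _) (def_pair bX (definable_wk Base Da) (definable_wk Base Dpad))).
  apply: def_if => //; first exact: (dec_lt_size bX Dfst (definable_wk Base Dc)).
  apply: def_take => //; apply: def_pair => //; apply: def_pair => //; last exact: (definable_wk Base Dpad).
  apply: def_take => //; first exact: (definable_wk Base Db).
  have Dphiu := definable_app (t1 := Base) (t2 := Arr Base Base) (definable_wk Base Dphi) Du.
  exact: (definable_app (t1 := Base) (t2 := Base) Dphiu (def_fst bX (def_snd bX Dz))).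
apply: def_fst => //; apply: def_snd => //.
have DI : definable SPT_class (t := Arr (Arr Base Base) (Arr Base Base)) (fun _ : env G => iterator).
  by apply: definable_closed; exists (Cst [::] (SPT_const iterator_SPT)).
exact: (definable_app (t1 := Base) (t2 := Base) (definable_app (t1 := Arr Base Base) DI Dstep) Dpad).
Qed.

(** * Equality of the two classes *)

Theorem mainTheorem9 :
  forall (t : ty) (f : den t), lambda SPT_class f <-> BFF f.
Proof.
move=> t f; split; apply: lambda_sub => {t f} t f.
  case=> F SPT_F; apply: SPT_lambda SPT_F; first exact: FP_basic_closed.
  by exists (Cst [::] (or_intror limrec_const : cup_class FP_class _ (limrec : den limrec_ty))).
case=> [[k g FPg]|[]]; last exact: SPT_limrec.
exact: FP_lambda SPT_basic_closed SPT_limrec FPg.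
Qed.
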